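(* Let $A=\{a_1<a_2<\cdots\}$ and $B=\{b_1<b_2<\cdots\}$ be two infinite subsets of $\mathbb{N}$ such that $$a_i-b_i=o\big(a_i^{\frac14}\big)\qquad\text{as } i\to+\infty .$$ Then there is no constant $c>0$ for which $$R_{A,B}(n)=cn+o\big(n^{\frac14}\big)\qquad\text{as } n\to\infty .$$
   Context: $\mathbb{N}$ denotes the set of nonnegative integers. For $A,B\subseteq\mathbb{N}$ and $n\in\mathbb{N}$, $R_{A,B}(n)=|\{(a,b): a\in A,\ b\in B,\ a+b\leq n\}|$. The elements of infinite sets are listed in increasing order, so $a_i$ (resp. $b_i$) is the $i$-th smallest element of $A$ (resp. $B$). *)

(* Defs.v *)
From mathcomp Require Import all_boot all_order all_algebra finmap.
From mathcomp Require Import all_classical all_reals all_analysis.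

Set Implicit Arguments.
Unset Strict Implicit.
Unset Printing Implicit Defensive.

Local Open Scope classical_set_scope.

(* [a i] is the (i+1)-th smallest element of [A]: indices start at 0. *)
Definition lists_in_order (a : nat -> nat) (A : set nat) : Prop :=
  increasing_seq a /\ range a = A.

Definition rep_pairs (A B : set nat) (n : nat) : set (nat * nat) :=
  [set p | [/\ A p.1, B p.2 & p.1 + p.2 <= n]].

(* [fset_set] returns the empty set on infinite sets, so this is needed for
   [#|` fset_set (rep_pairs A B n)|] to be the actual cardinality. *)
Lemma finite_rep_pairs (A B : set nat) (n : nat) :
  finite_set (rep_pairs A B n).
Proof.
apply: (@sub_finite_set _ _ (`I_n.+1 `*` `I_n.+1)).
  move=> [x y] [_ _ /= le_xy_n]; split; rewrite /= ltnS.
    exact: leq_trans (leq_addr _ _) le_xy_n.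
  exact: leq_trans (leq_addl _ _) le_xy_n.
by apply: finite_setX; apply: finite_II.
Qed.

Definition rep_count (A B : set nat) (n : nat) : nat :=
  #|` fset_set (rep_pairs A B n)|%fset.

(* Main.v *)
Require Import Defs.
From mathcomp Require Import all_boot all_order all_algebra.
From mathcomp Require Import all_solvable separable cyclotomic.
From mathcomp Require Import finmap complex ring lra zify.
From mathcomp Require Import all_classical all_reals all_analysis.
Import Order.TTheory GRing.Theory Num.Theory.
Import numFieldNormedType.Exports.
Import ComplexField.Normc.
Local Open Scope classical_set_scope.
Local Open Scope ring_scope.

Set Implicit Arguments.
Unset Strict Implicit.
Unset Printing Implicit Defensive.

(** Suppose that the pairs are counted by c n + o(n^(1/4)) with c > 0. Let s be the
    sum and t the difference of the indicators of A and B, let P be the difference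
    of their counting functions, so that t(y) = (1 - y) P(y), and let E_n be the
    error R(n) - c (n + 1). As s^2 - t^2 is four times the product of the
    generating functions of A and B,
      S(y)^2 = 4 c / (1 - y) + 4 (1 - y) E(y) + ((1 - y) P(y))^2.
    The main term is the square of V(y) = 2 sqrt c (1 - y)^(-1/2), whose
    coefficients are central binomial ones ([central_coef_convolution]). So S and
    V have nearly the same square, but S has integer coefficients that are mostly
    zero, whereas V is spread out. The proof plays this against the identity.

    Let h = 1 + y + ... + y^(M-1), and consider the circle |y|^2 = x with
    1 - x = (L M)^(-2), where L is a large constant and M tends to infinity. The
    coefficients of h S are the counts w_n of windows of length M. Absolute values
    in the identity bound the mean square of h S by the one of h V, up to error
    terms ([circle_inequality]). Since E_n = o(n^(1/4)), and since the mean square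
    of P is governed by the gaps a_i - b_i ([count_diff_energy]), these errors are
    O(M^2) with a constant that does not depend on L, once M is large.

    In the opposite direction, w_n^2 >= w_n because w_n is a natural number, while
    the window v_n of V is small beyond n0 = O(M^2). Hence the mean square of h S
    exceeds the one of h V by about half of the sum of w_n x^n, of order L M^2,
    provided that the correlation of v with w - v is at least -O(M^2)
    ([window_energy_gain]). Bounding this correlation termwise would lose a
    logarithm. Instead v_n is replaced by a multiple of the central coefficient of
    index n + M ([window_approx]), and the central coefficients are moments of a
    probability on [0, 1] ([central_coef_moment]), so that the correlation is an
    average of values of S - V on the real axis. These are bounded, for
    S - V = (S^2 - V^2) / (S + V) and both S and V are positive there
    ([real_axis_bound]). For L large, L M^2 <= O(M^2) is absurd.

    All series are truncated at a large degree X, at the price of a polynomial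
    with coefficients beyond X only ([tail_poly]), and the circle is replaced by
    the Q-th roots of unity with Q large, for which Parseval's identity is exact
    ([discrete_parseval]): every sum in the proof is finite. *)

(** * Averages over roots of unity *)

Lemma prim_root_exists (R : rcfType) (Q : nat) : (0 < Q)%N ->
  exists w : R[i], Q.-primitive_root w.
Proof.
move=> Q0; have [rs rsE] := closed_field_poly_normal ('X^Q - 1 : {poly R[i]}).
rewrite (monicP (monicXnsubC 1 Q0)) scale1r in rsE.
have urs : uniq rs.
  rewrite -separable_prod_XsubC -rsE separable_Xn_sub_1 //.
  by rewrite pnatr_eq0 -lt0n.
have szrs : size rs = Q.
  by apply/eqP; rewrite -eqSS -(size_prod_XsubC rs id) -rsE size_XnsubC.
have rts : all Q.-unity_root rs.
  by apply/allP => z; rewrite -root_prod_XsubC -rsE.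
by have /hasP[w _ wP] := has_prim_root Q0 rts urs (eq_leq (esym szrs)); exists w.
Qed.

Lemma sum_prim_root_expr (F : fieldType) (Q : nat) (w : F) (m : nat) :
  Q.-primitive_root w ->
  \sum_(k < Q) (w ^+ k) ^+ m = if (Q %| m)%N then Q%:R else 0.
Proof.
move=> wP; rewrite (prim_order_dvd wP); case: eqP => [wm1|/eqP wm1].
  rewrite (eq_bigr (fun=> 1)) ?sumr_const ?card_ord// => k _.
  by rewrite exprAC wm1 expr1n.
have wm0 : w ^+ m - 1 != 0 by rewrite subr_eq0.
apply: (mulfI wm0); rewrite mulr0.
under eq_bigr do rewrite exprAC.
by rewrite -subrX1 exprAC (prim_expr_order wP) expr1n subrr.
Qed.

Lemma normc_ge0 (R : rcfType) (z : R[i]) : 0 <= normc z.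
Proof. by case: z => a b; rewrite /normc sqrtr_ge0. Qed.

Lemma normc_sum (R : rcfType) (n : nat) (F : 'I_n -> R[i]) :
  normc (\sum_(i < n) F i) <= \sum_(i < n) normc (F i).
Proof.
elim/big_ind2: _ => [|x1 x2 y1 y2 h1 h2|i _] //; first by rewrite normc0.
by apply: le_trans (le_normcD _ _) _; apply: lerD.
Qed.

Lemma normcX (R : rcfType) (z : R[i]) n : normc (z ^+ n) = normc z ^+ n.
Proof. by elim: n => [|n IH]; rewrite ?normc1 // !exprS normcM IH. Qed.

Lemma normc_real (R : rcfType) (a : R) : normc (a%:C)%C = `|a|.
Proof. by rewrite /= expr0n addr0 sqrtr_sqr. Qed.

Lemma sqr_normcE (R : rcfType) (z : R[i]) :
  ((normc z) ^+ 2)%:C%C = z * conjc z.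
Proof.
by rewrite -sqr_normc normc_def rmorphXn; case: z.
Qed.

Lemma normc_prim_root (R : rcfType) (Q : nat) (w : R[i]) (k : nat) :
  (0 < Q)%N -> Q.-primitive_root w -> normc (w ^+ k) = 1.
Proof.
move=> Q0 wP.
have : normc w ^+ Q = 1 by rewrite -normcX (prim_expr_order wP) normc1.
by move/eqP; rewrite pexpr_eq1 ?normc_ge0 // normcX => /eqP ->; rewrite expr1n.
Qed.

(** The exponent Q - 1 stands for -1, which keeps all exponents natural. *)
Lemma conjc_prim_root (R : rcfType) (Q : nat) (w : R[i]) (k : nat) :
  (0 < Q)%N -> Q.-primitive_root w -> conjc (w ^+ k) = (w ^+ k) ^+ Q.-1.
Proof.
move=> Q0 wP; have nw1 := normc_prim_root k Q0 wP.
have wk0 : w ^+ k != 0.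
  by apply/eqP => wk0; move/eqP: nw1; rewrite wk0 normc0 eq_sym oner_eq0.
apply: (mulfI wk0); rewrite -sqr_normcE nw1 -exprS prednK // expr1n.
by rewrite exprAC (prim_expr_order wP) expr1n.
Qed.

(** Averaging over the Q-th roots of unity, with Q larger than the degree, is as
    good as integrating over the circle of radius r, and needs no integral. *)
Lemma discrete_parseval (R : rcfType) (Q : nat) (w : R[i]) (p : {poly R}) (r : R) :
  (0 < Q)%N -> Q.-primitive_root w -> (size p <= Q)%N ->
  \sum_(k < Q) normc (map_poly (real_complex R) p).[r%:C%C * w ^+ k] ^+ 2 =
  Q%:R * \sum_(n < Q) p`_n ^+ 2 * (r ^+ 2) ^+ n.
Proof.
move=> Q0 wP szp; apply: complexI.
have hornE (k : nat) : (map_poly (real_complex R) p).[r%:C%C * w ^+ k] =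
    \sum_(n < Q) (p`_n * r ^+ n)%:C%C * (w ^+ k) ^+ n.
  rewrite (@horner_coef_wide _ Q) ?size_map_poly //; apply: eq_bigr => n _.
  by rewrite coef_map exprMn mulrA rmorphM rmorphXn.
have conjE (k : nat) : conjc (map_poly (real_complex R) p).[r%:C%C * w ^+ k] =
    \sum_(m < Q) (p`_m * r ^+ m)%:C%C * (w ^+ k) ^+ (Q.-1 * m).
  rewrite hornE rmorph_sum; apply: eq_bigr => m _.
  rewrite [LHS]rmorphM [X in _ * X]rmorphXn [X in X * _]conjc_real.
  by rewrite exprM; congr (_ * _ ^+ _); exact: conjc_prim_root.
rewrite rmorph_sum /=.
under eq_bigr => k _.
  rewrite sqr_normcE conjE hornE mulr_suml.
  under eq_bigr => n _.
    rewrite mulr_sumr.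
    under eq_bigr => m _ do rewrite mulrACA -rmorphM -exprD.
    over.
  over.
rewrite exchange_big rmorphM rmorph_sum mulr_sumr; apply: eq_bigr => n _ /=.
rewrite exchange_big (bigD1 n) //= -mulr_sumr (sum_prim_root_expr _ wP).
have -> : (n + Q.-1 * n = Q * n)%N by rewrite -mulSn prednK.
rewrite dvdn_mulr //.
rewrite big1 ?addr0 => [|m mn].
  rewrite mulrC rmorph_nat; congr (_ * _%:C%C); rewrite -exprM mulnC exprM; ring.
rewrite -mulr_sumr (sum_prim_root_expr _ wP) ifF ?mulr0 //.
apply: contra_neqF mn => /dvdnP[q qE]; apply/val_inj => /=.
have [nQ mQ] := (ltn_ord n, ltn_ord m).
have : ((n + Q.-1 * m) + m = m %[mod Q])%N by rewrite qE modnMDl.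
rewrite -addnA -[X in (_ + (_ + X))%N]mul1n -mulnDl addn1 prednK //.
by rewrite addnC mulnC modnMDl !modn_small.
Qed.

(** * Central binomial coefficients *)

(** The coefficients of (1 - y)^(-1/2). *)
Definition central_coef (R : fieldType) (n : nat) : R := 'C(n.*2, n)%:R / 4 ^+ n.

(** Only the constant term of ((z + 1/z) / 2)^(2m) survives the average over the
    Q-th roots of unity. Thus the central coefficients are the moments of the
    probability carried by the points (Re z)^2 of [0, 1]. *)
Lemma central_coef_moment (R : rcfType) (Q : nat) (w : R[i]) (m : nat) :
  Q.-primitive_root w -> (m.*2 < Q)%N ->
  \sum_(k < Q) complex.Re (w ^+ k) ^+ m.*2 = Q%:R * central_coef R m.
Proof.
move=> wP mQ; have Q0 : (0 < Q)%N by exact: leq_ltn_trans mQ.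
apply: complexI; rewrite rmorph_sum /=.
have ReE (k : nat) : ((complex.Re (w ^+ k) ^+ m.*2)%:C)%C =
    (\sum_(i < m.*2.+1) (w ^+ k) ^+ (m.*2 - i + Q.-1 * i) *+ 'C(m.*2, i)) / 4 ^+ m.
  have -> : ((complex.Re (w ^+ k) ^+ m.*2)%:C)%C =
      ((complex.Re (w ^+ k))%:C)%C ^+ m.*2 by rewrite rmorphXn.
  rewrite ReJ_add expr_div_n exprDn (conjc_prim_root k Q0 wP).
  congr (_ / _); last by rewrite -mul2n exprM; congr (_ ^+ m); rewrite -natrX.
  by apply: eq_bigr => i _; rewrite exprD exprM.
under eq_bigr do rewrite ReE.
rewrite -mulr_suml exchange_big /= (bigD1 (inord m)) //=.
have mE : (inord m : 'I_m.*2.+1) = m :> nat by rewrite inordK // -addnn ltnS leq_addr.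
rewrite !mE sumrMnl (sum_prim_root_expr _ wP) ifT; last first.
  have -> : (m.*2 - m + Q.-1 * m = Q * m)%N by rewrite -addnn addnK -mulSn prednK.
  exact: dvdn_mulr.
rewrite big1 ?addr0 => [|i im].
  rewrite /central_coef !rmorphM fmorphV rmorphXn !rmorph_nat /=.
  by rewrite -[Q%:R *+ _]mulr_natr mulrA.
under eq_bigr do rewrite -mulr_natr.
rewrite -mulr_suml (sum_prim_root_expr _ wP) ifF ?mul0r //.
apply: contra_neqF im => /dvdnP[q qE]; apply/val_inj; rewrite /= mE.
move: qE (ltn_ord i); rewrite ltnS; move: (nat_of_ord i) => {}i qE im2.
have e : ((m.*2 - i + Q.-1 * i) + i.*2 = m.*2 + Q * i)%N.
  by rewrite -[in RHS](prednK Q0) mulSn; move: (Q.-1 * i)%N im2 => z; clear; lia.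
have e2 : (q * Q + i.*2 = i * Q + m.*2)%N by rewrite -qE e addnC mulnC.
have e3 : (i.*2 = m.*2 %[mod Q])%N by rewrite -(modnMDl q) e2 modnMDl.
have [i2Q|Qi2] := ltnP i.*2 Q; first by rewrite !modn_small // in e3; lia.
have e4 : (i.*2 - Q = m.*2)%N.
  move: e3; rewrite -{1}(subnK Qi2) modnDr !modn_small //; lia.
lia.
Qed.

(** Being moments on [0, 1], the central coefficients turn the values of a
    polynomial on a segment of the real axis into weighted sums of its
    coefficients. This controls the correlation of S - V with the smooth model
    without the logarithm that absolute values would cost. *)
Lemma central_coef_average (R : rcfType) (p : {poly R}) (k : nat) (x C : R) :
  0 <= x -> (forall y, 0 <= y <= x -> `|p.[y]| <= C) ->
  `|\sum_(n < size p) p`_n * central_coef R (n + k) * x ^+ n| <= C.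
Proof.
(* Q exceeds twice every index n + k, so all the moments below are exact. *)
move=> x0 pC; pose Q := (size p + k).*2.+1.
have [w wP] := @prim_root_exists R Q isT.
have Q0 : (0 : R) < Q%:R by rewrite ltr0n.
pose c (j : nat) := complex.Re (w ^+ j).
have c2 j : 0 <= c j ^+ 2 <= 1.
  rewrite sqr_ge0 /=; have := normc_prim_root j (isT : 0 < Q)%N wP.
  rewrite /c; case: (w ^+ j) => a b /= ab.
  have : 0 <= a ^+ 2 + b ^+ 2 by rewrite addr_ge0 ?sqr_ge0.
  by move/sqr_sqrtr; rewrite ab expr1n => ->; rewrite lerDl sqr_ge0.
have sumE : \sum_(n < size p) p`_n * central_coef R (n + k) * x ^+ n =
    Q%:R^-1 * \sum_(j < Q) (c j ^+ 2) ^+ k * p.[x * c j ^+ 2].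
  apply: (mulfI (lt0r_neq0 Q0)); rewrite mulVKf ?lt0r_neq0 // mulr_sumr.
  under [RHS]eq_bigr do rewrite horner_coef mulr_sumr.
  rewrite exchange_big; apply: eq_bigr => n _ /=.
  have nkQ : ((n + k).*2 < Q)%N by rewrite ltnS leq_double leq_add2r ltnW.
  transitivity (Q%:R * central_coef R (n + k) * (p`_n * x ^+ n)); first by ring.
  rewrite -(central_coef_moment wP nkQ) mulr_suml.
  apply: eq_bigr => j _; rewrite -/(c j) -mul2n exprM; move: (c j ^+ 2) => d.
  by rewrite exprD exprMn; ring.
rewrite sumE normrM gtr0_norm ?invr_gt0 // mulrC ler_pdivrMr //.
apply: le_trans (ler_norm_sum _ _ _) _.
rewrite -[Q in _ * Q%:R]card_ord mulr_natr -sumr_const; apply: ler_sum => j _.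
have /andP[c0 c1] := c2 j; rewrite normrM normrX ger0_norm //.
have {}pC := pC (x * c j ^+ 2); apply: le_trans (pC _).
  by rewrite ler_piMl // exprn_ile1.
by rewrite mulr_ge0 //= ler_piMr.
Qed.

Lemma central_coef0 (R : fieldType) : central_coef R 0 = 1.
Proof. by rewrite /central_coef bin0 expr0 divr1. Qed.

Lemma central_coefS (R : numFieldType) (n : nat) :
  n.+1.*2%:R * central_coef R n.+1 = n.*2.+1%:R * central_coef R n.
Proof.
have e : (n.+1 * 'C(n.+1.*2, n.+1) = 2 * n.*2.+1 * 'C(n.*2, n))%N.
  apply/eqP; rewrite -(eqn_pmul2l (ltn0Sn n)); apply/eqP.
  have e1 := mul_bin_diag n.+1.*2 n.
  have e2 := mul_bin_diag n.*2.+1 n.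
  have e3 : 'C(n.*2.+1, n.+1) = 'C(n.*2.+1, n).
    by rewrite -[in LHS]bin_sub ?subSS -?addnn ?addnK // ltnS leq_addr.
  have e4 := mul_bin_diag n.+1.*2 n.
  rewrite -e1 /= doubleS /= -e3; move: e2 => /= e2.
  by rewrite mulnCA -e2 -mul2n; ring.
have eR : n.+1%:R * 'C(n.+1.*2, n.+1)%:R = 2 * n.*2.+1%:R * 'C(n.*2, n)%:R :> R.
  by rewrite -!natrM e.
have q0 : (4 ^+ n : R) != 0 by rewrite expf_neq0 // pnatr_eq0.
rewrite /central_coef -[in X in X * _]muln2 natrM exprS.
move: eR q0; move: (4 ^+ n) => q.
move: (n.+1%:R : R) ('C(n.+1.*2, n.+1)%:R : R) => a C' eR q0.
have -> : a * 2%:R * (C' / (4 * q)) = a * C' / (2 * q) by field.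
by rewrite eR; field.
Qed.

Lemma central_coef_gt0 (R : numFieldType) (n : nat) : 0 < central_coef R n.
Proof.
by rewrite divr_gt0 ?exprn_gt0 ?ltr0n // bin_gt0 -addnn leq_addr.
Qed.

Lemma central_coef_anti (R : realFieldType) (m n : nat) :
  (m <= n)%N -> central_coef R n <= central_coef R m.
Proof.
move=> /subnK <-; elim: (n - m)%N => [|k IH] //=; rewrite addSn.
apply: le_trans IH; set j := (k + m)%N.
have j0 : 0 < j.+1.*2%:R :> R by rewrite ltr0n.
by rewrite -(ler_pM2l j0) central_coefS ler_wpM2r ?ler_nat ?ltW ?central_coef_gt0.
Qed.

Lemma sum_central_coef (R : numFieldType) (n : nat) :
  \sum_(i < n) central_coef R i = n.*2%:R * central_coef R n.
Proof.
elim: n => [|n IH]; first by rewrite big_ord0 mul0r.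
by rewrite big_ord_recr /= IH central_coefS -[X in _ + X]mul1r -mulrDl -natr1.
Qed.

(** The left-hand side decreases with n, by the recurrence. *)
Lemma sqr_central_coef_le (R : realFieldType) (n : nat) :
  n.*2.+1%:R * central_coef R n ^+ 2 <= 1.
Proof.
elim: n => [|n IH]; first by rewrite central_coef0 expr1n mul1r.
apply: le_trans IH; have := central_coefS R n.
have -> : n.+1.*2.+1%:R = n.*2%:R + 3 :> R by rewrite -natrD addn3.
have -> : n.+1.*2%:R = n.*2%:R + 2 :> R by rewrite -natrD addn2.
have -> : n.*2.+1%:R = n.*2%:R + 1 :> R by rewrite natr1.
have : 0 <= n.*2%:R :> R by [].
move: (n.*2%:R : R) (central_coef R n) (central_coef R n.+1) => t g g' t0 e.
have t2 : 0 < t + 2 by rewrite ltr_wpDl.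
have -> : g' = (t + 1) * g / (t + 2) by rewrite -e mulrC mulKf // gt_eqF.
have -> : (t + 3) * ((t + 1) * g / (t + 2)) ^+ 2 =
    (t + 3) * (t + 1) / (t + 2) ^+ 2 * ((t + 1) * g ^+ 2).
  by field; rewrite gt_eqF.
apply: ler_piMl; first by apply: mulr_ge0; [exact: addr_ge0 | exact: sqr_ge0].
by rewrite ler_pdivrMr ?exprn_gt0 // mul1r; nra.
Qed.

(** The square of (1 - y)^(-1/2) is 1/(1 - y). By the recurrence and the symmetry
    of the sum, n c_n = 2 sum i g_i g_(n-i) yields (n+1) c_(n+1) = (n+1) c_n. *)
Lemma central_coef_convolution (R : numFieldType) (n : nat) :
  \sum_(i < n.+1) central_coef R i * central_coef R (n - i) = 1.
Proof.
set g := central_coef R; pose c n := \sum_(i < n.+1) g i * g (n - i)%N.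
have sym m : m%:R * c m = 2 * \sum_(i < m.+1) i%:R * (g i * g (m - i)%N).
  rewrite mulr_natl [RHS]mulr_natl [RHS]mulr2n [X in _ = X + _](reindex_inj rev_ord_inj) -big_split /=.
  rewrite /c -sumrMnl; apply: eq_bigr => i _.
  rewrite subSS subKn -1?ltnS // [g (m - i)%N * _]mulrC -mulrDl -natrD.
  by rewrite subnK -1?ltnS // mulr_natl.
elim: n => [|n IH].
  by rewrite big_ord_recl big_ord0 subnn /g central_coef0 mulr1 addr0.
rewrite -/(c n.+1) -[RHS]IH -/(c n).
have n0 : n.+1%:R != 0 :> R by rewrite pnatr_eq0.
apply: (mulfI n0); rewrite sym big_ord_recl mul0r add0r mulr_sumr.
rewrite -[n.+1%:R]natr1 [RHS]mulrDl mul1r sym mulr_sumr -big_split /=.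
apply: eq_bigr => i _; rewrite subSS /bump /= add1n.
have := central_coefS R i; rewrite -/(g i) -/(g i.+1) -!muln2.
rewrite -[(i * 2).+1%:R]natr1 !natrM => e.
by rewrite mulrA mulrA [2 * _]mulrC e; ring.
Qed.

(** * Mean squares on a circle *)

Lemma sum_le1 (R : numDomainType) (n : nat) (F : 'I_n -> R) :
  (forall i, F i <= 1) -> \sum_(i < n) F i <= n%:R.
Proof.
move=> F1; apply: le_trans (ler_sum _ (fun i _ => F1 i)) _.
by rewrite sumr_const card_ord.
Qed.

(** The mean square of p on the circle of radius sqrt x. *)
Definition wnorm2 (R : nzRingType) (x : R) (p : {poly R}) : R :=
  \sum_(n < size p) p`_n ^+ 2 * x ^+ n.

Definition wnorm1 (R : numDomainType) (x : R) (p : {poly R}) : R :=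
  \sum_(n < size p) `|p`_n| * x ^+ n.

Lemma sum_coef_wide (R : nzRingType) (V : nmodType) (F : R -> nat -> V)
    (p : {poly R}) (m : nat) :
  (forall n, F 0 n = 0) -> (size p <= m)%N ->
  \sum_(n < size p) F p`_n n = \sum_(n < m) F p`_n n.
Proof.
move=> F0 pm; rewrite (big_ord_widen _ (fun n => F p`_n n) pm) big_mkcond /=.
by apply: eq_bigr => n _; case: ltnP => // pn; rewrite nth_default.
Qed.

Lemma wnorm2_wide (R : nzRingType) (x : R) (p : {poly R}) (m : nat) :
  (size p <= m)%N -> wnorm2 x p = \sum_(n < m) p`_n ^+ 2 * x ^+ n.
Proof.
apply: (sum_coef_wide (F := fun c n => c ^+ 2 * x ^+ n)) => n.
by rewrite expr0n mul0r.
Qed.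

Lemma wnorm1_wide (R : numDomainType) (x : R) (p : {poly R}) (m : nat) :
  (size p <= m)%N -> wnorm1 x p = \sum_(n < m) `|p`_n| * x ^+ n.
Proof.
apply: (sum_coef_wide (F := fun c n => `|c| * x ^+ n)) => n.
by rewrite normr0 mul0r.
Qed.

Lemma horner_le_wnorm1 (R : numDomainType) (x : R) (p : {poly R}) :
  0 <= x -> `|p.[x]| <= wnorm1 x p.
Proof.
move=> x0; rewrite horner_coef; apply: le_trans (ler_norm_sum _ _ _) _.
by apply: ler_sum => n _; rewrite normrM normrX (ger0_norm x0).
Qed.

Definition geom_poly (R : nzRingType) (M : nat) : {poly R} := \sum_(j < M) 'X^j.

Lemma normc_horner_le (R : rcfType) (p : {poly R}) (z : R[i]) :
  normc (map_poly (real_complex R) p).[z] <= wnorm1 (normc z) p.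
Proof.
rewrite (@horner_coef_wide _ (size p)) ?size_map_poly //.
apply: le_trans (normc_sum _) _; apply: ler_sum => n _.
by rewrite coef_map normcM normcX normc_real.
Qed.

(** Absolute values are taken in the identity for S^2, multiplied by |h|^2 with
    h = 1 + y + ... + y^(M-1), and averaged over the circle. The factors 1 - y
    are absorbed by |h| |1 - y| = |1 - y^M| <= 2, which leaves |h| |E| for the
    error term, split by the arithmetic-geometric inequality with parameter eta. *)
Lemma circle_inequality (R : rcfType) (S V E P Z : {poly R}) (r tau eta : R)
    (M : nat) :
  0 <= r <= 1 -> 0 < eta ->
  S ^+ 2 = V ^+ 2 + 4 *: ((1 - 'X) * E) + ((1 - 'X) * P) ^+ 2 + Z ->
  wnorm1 r Z <= tau ->
  wnorm2 (r ^+ 2) (geom_poly R M * S) <=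
    wnorm2 (r ^+ 2) (geom_poly R M * V)
    + 4 * (eta * M%:R + wnorm2 (r ^+ 2) E / eta)
    + 4 * wnorm2 (r ^+ 2) P + M%:R ^+ 2 * tau.
Proof.
move=> /andP[r0 r1] eta0 SE Ztau; set h := geom_poly R M.
(* Q exceeds the size of every polynomial involved: the average is then exact. *)
pose Q := (size (h * S)%R + size (h * V)%R + size E + size P + size h).+1.
have [w wP] := @prim_root_exists R Q isT.
have Q0 : (0 : R) < Q%:R by rewrite ltr0n.
pose y (k : nat) : R[i] := (r%:C)%C * w ^+ k.
pose ev (p : {poly R}) k := normc (map_poly (real_complex R) p).[y k].
have ny k : normc (y k) = r.
  by rewrite /y normcM (normc_prim_root k (ltn0Sn _) wP) mulr1 normc_real ger0_norm.
have parse (p : {poly R}) : (size p <= Q)%N -> \sum_(k < Q) ev p k ^+ 2 = Q%:R * wnorm2 (r ^+ 2) p.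
  by move=> pQ; rewrite (wnorm2_wide _ pQ) -(discrete_parseval r (ltn0Sn _) wP pQ).
have evM (p q : {poly R}) k : ev (p * q) k = ev p k * ev q k.
  by rewrite /ev rmorphM hornerM normcM.
have ev0 p k : 0 <= ev p k by exact: normc_ge0.
have hM k : ev h k <= M%:R.
  rewrite /ev /h /geom_poly rmorph_sum horner_sum.
  apply: le_trans (normc_sum _) _; apply: sum_le1 => i.
  by rewrite rmorphXn /= map_polyX hornerXn normcX ny exprn_ile1.
have evX n k : ev (1 - 'X^n) k <= 2.
  rewrite /ev rmorphB rmorph1 rmorphXn /= map_polyX !hornerE.
  apply: le_trans (le_normcD _ _) _; rewrite normcN normc1 normcX ny.
  by rewrite -natr1 lerD2l exprn_ile1.
(* (1 - y) h = 1 - y^M stays bounded although h itself can be as large as M. *)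
have hX k : ev h k * ev (1 - 'X) k <= 2.
  rewrite -evM [h * _]mulrC (_ : _ * h = 1 - 'X^M) //.
  by rewrite -opprB mulNr -subrX1 opprB.
have key k : ev (h * S) k ^+ 2 <= ev (h * V) k ^+ 2
    + 4 * (eta * ev h k ^+ 2 + ev E k ^+ 2 / eta) + 4 * ev P k ^+ 2
    + M%:R ^+ 2 * tau.
  have Z0 : ev Z k <= tau by apply: le_trans Ztau; rewrite -(ny k) normc_horner_le.
  have S2 : ev S k ^+ 2 <= ev V k ^+ 2 + 4 * (ev (1 - 'X) k * ev E k)
      + (ev (1 - 'X) k * ev P k) ^+ 2 + ev Z k.
    have e4 : ev (4 *: ((1 - 'X) * E)) k = 4 * (ev (1 - 'X) k * ev E k).
      rewrite -mul_polyC !evM; congr (_ * _).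
      by rewrite /ev map_polyC hornerC normc_real ger0_norm.
    rewrite -e4 -evM !expr2 -!evM -!expr2 SE /ev !rmorphD !hornerD.
    apply: le_trans (le_normcD _ _) _; rewrite lerD2r.
    apply: le_trans (le_normcD _ _) _; rewrite lerD2r.
    exact: le_normcD.
  rewrite !evM; move: (hM k) (hX k) (ev0 h k) (ev0 E k) (ev0 P k) (ev0 (1 - 'X) k) S2 Z0.
  move: (ev h k) (ev S k) (ev V k) (ev E k) (ev P k) (ev (1 - 'X) k) (ev Z k).
  move=> H s v e p d z HM Hd H0 e0 p0 d0 S2 Z0.
  have HH : H ^+ 2 <= M%:R ^+ 2 by rewrite ler_sqr ?nnegrE.
  have t0 : 0 <= tau.
    by apply: le_trans Ztau; apply: sumr_ge0 => n _; rewrite mulr_ge0 ?exprn_ge0.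
  have b1 : (H * s) ^+ 2 <= H ^+ 2 * (v ^+ 2 + 4 * (d * e) + (d * p) ^+ 2 + z).
    by rewrite exprMn ler_wpM2l ?sqr_ge0.
  have b2 : H ^+ 2 * z <= M%:R ^+ 2 * tau.
    apply: le_trans (ler_wpM2l (sqr_ge0 _) Z0) _; exact: ler_wpM2r.
  have b3 : (H * d) * (H * e) <= 2 * (H * e) by rewrite ler_wpM2r ?mulr_ge0.
  have b4 : (H * d * p) ^+ 2 <= 4 * p ^+ 2.
    rewrite exprMn ler_wpM2r ?sqr_ge0 //.
    by move: (mulr_ge0 H0 d0) Hd; move: (H * d) => t *; nra.
  have b5 : 2 * (H * e) <= eta * H ^+ 2 + e ^+ 2 / eta.
    rewrite -subr_ge0; have -> : eta * H ^+ 2 + e ^+ 2 / eta - 2 * (H * e)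
      = (eta * H - e) ^+ 2 / eta by field; rewrite gt_eqF.
    by rewrite divr_ge0 ?sqr_ge0 // ltW.
  apply: le_trans b1 _.
  have -> : H ^+ 2 * (v ^+ 2 + 4 * (d * e) + (d * p) ^+ 2 + z) =
    (H * v) ^+ 2 + 4 * ((H * d) * (H * e)) + (H * d * p) ^+ 2 + H ^+ 2 * z by ring.
  lra.
have hle : wnorm2 (r ^+ 2) h <= M%:R.
  have hsz : (size h <= M)%N.
    by apply: (leq_trans (size_sum _ _ _)); apply/bigmax_leqP => j _; rewrite size_polyXn.
  rewrite (wnorm2_wide _ hsz); apply: sum_le1 => n; rewrite coef_sum (bigD1 n) //= coefXn eqxx big1 ?addr0.
    by rewrite expr1n mul1r exprn_ile1 ?exprn_ile1 ?exprn_ge0.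
  by move=> j jn; rewrite coefXn eq_sym (inj_eq val_inj) (negbTE jn).
have Esz (p : {poly R}) : (size p <= Q)%N -> wnorm2 (r ^+ 2) p = Q%:R^-1 * \sum_(k < Q) ev p k ^+ 2.
  by move=> pQ; rewrite parse // mulKf // gt_eqF.
have Qsz : [/\ size (h * S)%R <= Q, size (h * V)%R <= Q, size E <= Q, size P <= Q
    & size h <= Q]%N by rewrite /Q; split; lia.
case: Qsz => q1 q2 q3 q4 q5.
apply: (@le_trans _ _ (wnorm2 (r ^+ 2) (h * V)
    + 4 * (eta * wnorm2 (r ^+ 2) h + wnorm2 (r ^+ 2) E / eta)
    + 4 * wnorm2 (r ^+ 2) P + M%:R ^+ 2 * tau)); last first.
  by rewrite !lerD2r lerD2l ler_pM2l ?ltr0n // lerD2r ler_pM2l.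
rewrite !Esz // -(ler_pM2l Q0) [leLHS]mulVKf ?gt_eqF //.
apply: le_trans (ler_sum _ (fun (k : 'I_Q) _ => key k)) _.
rewrite !big_split /= -!mulr_sumr !big_split /= -!mulr_sumr -mulr_suml.
rewrite sumr_const card_ord -[_ *+ Q]mulr_natl.
rewrite le_eqVlt; apply/orP; left; apply/eqP; field; rewrite !gt_eqF //.
Qed.

(** * Geometric weights *)

Lemma ler_sum_widen (R : numDomainType) (F : nat -> R) (m n : nat) :
  (forall i, 0 <= F i) -> (m <= n)%N -> \sum_(i < m) F i <= \sum_(i < n) F i.
Proof.
by move=> F0 mn; rewrite -(subnKC mn) big_split_ord /= lerDl sumr_ge0.
Qed.

Lemma bernoulli_ge (R : realFieldType) (t : R) (n : nat) :
  0 <= t <= 1 -> 1 - n%:R * t <= (1 - t) ^+ n.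
Proof.
move=> /andP[t0 t1]; elim: n => [|n IH]; first by rewrite mul0r subr0.
have s0 : 0 <= 1 - t by rewrite subr_ge0.
rewrite exprS; apply: le_trans (ler_wpM2l s0 IH).
have : 0 <= n%:R :> R by []. rewrite -natr1; move: (n%:R : R) => m; nra.
Qed.

Lemma geom_sum_le (R : realFieldType) (y : R) (m : nat) :
  0 <= y < 1 -> \sum_(n < m) y ^+ n <= (1 - y)^-1.
Proof.
move=> /andP[y0 y1]; have y1' : 0 < 1 - y by rewrite subr_gt0.
rewrite -[leRHS]mul1r ler_pdivlMr // mulrC -opprB mulNr -subrX1 opprB.
by rewrite gerBl exprn_ge0.
Qed.

Lemma natmul_geom_le (R : realFieldType) (y : R) (m : nat) :
  0 <= y < 1 -> m%:R * y ^+ m <= (1 - y)^-1.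
Proof.
move=> y01; apply: le_trans (geom_sum_le m y01); case/andP: y01 => y0 y1.
rewrite mulr_natl -[m in _ *+ m]card_ord -sumr_const; apply: ler_sum => i _.
by apply: ler_wiXn2l => //; [exact: ltW | exact: ltnW].
Qed.

Lemma sum_natmul_geom_le (R : realFieldType) (y : R) (m : nat) :
  0 <= y < 1 -> \sum_(n < m) n.+1%:R * y ^+ n <= (1 - y) ^- 2.
Proof.
move=> y01; have y1' : 0 < 1 - y by case/andP: y01 => _; rewrite subr_gt0.
have e : (1 - y) * (\sum_(n < m) n.+1%:R * y ^+ n) =
    \sum_(n < m) y ^+ n - m%:R * y ^+ m.
  elim: m => [|m IH]; first by rewrite !big_ord0 mulr0 mul0r subr0.
  by rewrite !big_ord_recr /= mulrDr IH exprS -natr1; ring.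
rewrite -(ler_pM2l y1') e expr2 invfM mulrA divff ?gt_eqF // mul1r.
apply: le_trans (geom_sum_le m y01); rewrite gerBl mulr_ge0 ?exprn_ge0 //.
by case/andP: y01.
Qed.

Lemma exp_mul_geom_bounded (R : rcfType) (q : R) (k : nat) :
  0 <= q < 1 -> exists C, forall n, n%:R ^+ k * q ^+ n <= C.
Proof.
elim: k q => [|k IH] q /andP[q0 q1].
  by exists 1 => n; rewrite mul1r exprn_ile1 // ltW.
have s01 : 0 <= Num.sqrt q < 1 by rewrite sqrtr_ge0 -sqrtr1 ltr_sqrt.
(* One factor sqrt q pays for one power of n. *)
have [C hC] := IH _ s01; exists (C * (1 - Num.sqrt q)^-1) => n.
rewrite -[q in leLHS]sqr_sqrtr // exprAC expr2 exprSr mulrACA.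
by apply: ler_pM; rewrite ?mulr_ge0 ?exprn_ge0 ?sqrtr_ge0 ?natmul_geom_le.
Qed.

Lemma exp_mul_geom_small (R : realType) (q e : R) (k : nat) :
  0 <= q < 1 -> 0 < e -> exists m, forall n, (m <= n)%N -> n%:R ^+ k * q ^+ n <= e.
Proof.
move=> q01 e0; have [C hC] := @exp_mul_geom_bounded R q k.+1 q01.
exists (Num.truncn (C / e)).+1 => n mn.
have n0 : 0 < n%:R :> R by rewrite ltr0n; apply: leq_trans mn.
rewrite -(ler_pM2l n0) mulrA -exprS; apply: le_trans (hC n) _.
rewrite -ler_pdivrMr //; apply: ltW; apply: lt_le_trans (truncnS_gt _) _.
by rewrite ler_nat.
Qed.

(** Bounds p of size n^(1/4) are used through their fourth powers; this and the next
    lemma recover linear and quadratic information at a chosen scale l. *)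
Lemma le_add_quartic (R : realFieldType) (p l : R) :
  0 < l -> `|p| <= l + p ^+ 4 / l ^+ 3.
Proof.
move=> l0; have l3 : 0 < l ^+ 3 by rewrite exprn_gt0.
have p4 : p ^+ 4 = `|p| ^+ 4 by rewrite -normrX ger0_norm // exprn_even_ge0.
rewrite p4; have [pl|lp] := leP `|p| l.
  by apply: le_trans pl _; rewrite lerDl divr_ge0 ?exprn_ge0 // ltW.
apply: ler_wpDl; first exact: ltW.
by rewrite ler_pdivlMr // [leRHS]exprS ler_wpM2l // lerXn2r ?nnegrE // ltW.
Qed.

Lemma sqr_le_add_quartic (R : realFieldType) (p l : R) :
  0 < l -> p ^+ 2 <= (l + p ^+ 4 / l) / 2.
Proof.
move=> l0; rewrite -subr_ge0.
have -> : (l + p ^+ 4 / l) / 2 - p ^+ 2 = (l - p ^+ 2) ^+ 2 / l / 2.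
  by field; rewrite gt_eqF.
by rewrite !divr_ge0 ?sqr_ge0 // ltW.
Qed.

(** The bound is of order (1 - y)^(-3/2) when l is of order (1 - y)^(-1/2), as it
    should be for p n of order n^(1/4). *)
Lemma sum_sqr_le_quartic (R : realFieldType) (p : nat -> R) (l e C y : R) (m : nat) :
  0 < l -> 0 <= e -> 0 <= C -> 0 <= y < 1 ->
  (forall n, p n ^+ 4 <= e * n.+1%:R + C) ->
  \sum_(n < m) p n ^+ 2 * y ^+ n <=
    (l / (1 - y) + (e / (1 - y) ^+ 2 + C / (1 - y)) / l) / 2.
Proof.
move=> l0 e0 C0 y01 pC; have y0 : 0 <= y by case/andP: y01.
apply: (@le_trans _ _ (\sum_(n < m)
    (l * y ^+ n + (e * (n.+1%:R * y ^+ n) + C * y ^+ n) / l) / 2)).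
  apply: ler_sum => n _; rewrite (mulrA e) -mulrDl.
  have -> : (l * y ^+ n + (e * n.+1%:R + C) * y ^+ n / l) / 2 =
    (l + (e * n.+1%:R + C) / l) / 2 * y ^+ n by field; rewrite gt_eqF.
  rewrite ler_wpM2r ?exprn_ge0 //; apply: le_trans (sqr_le_add_quartic _ l0) _.
  by rewrite ler_pM2r ?invr_gt0 // lerD2l ler_pM2r ?invr_gt0.
rewrite -mulr_suml ler_pM2r ?invr_gt0 // big_split /= -mulr_sumr -mulr_suml.
rewrite big_split /= -!mulr_sumr.
apply: lerD; first by rewrite ler_pM2l // geom_sum_le.
rewrite ler_pM2r ?invr_gt0 //; apply: lerD; apply: ler_wpM2l => //.
  exact: sum_natmul_geom_le.
exact: geom_sum_le.
Qed.

Lemma wnorm1_le_quartic (R : rcfType) (p : {poly R}) (C y q : R) :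
  0 <= C -> 0 <= y < 1 -> 0 < q -> q ^+ 4 = (1 - y)^-1 ->
  (forall n, p`_n ^+ 4 <= C * n.+1%:R) ->
  (1 - y) * wnorm1 y p <= (1 + C) * q.
Proof.
move=> C0 y01 q0 qE pC; have y0 : 0 <= y by case/andP: y01.
have y1 : 0 < 1 - y by case/andP: y01 => _; rewrite subr_gt0.
have -> : (1 + C) * q = (1 - y) * (q * (1 - y)^-1 + C / q ^+ 3 * (1 - y) ^- 2).
  by rewrite -exprVn -qE -[1 - y]invrK -qE; field; rewrite gt_eqF.
rewrite ler_pM2l //.
apply: (@le_trans _ _ (\sum_(n < size p) (q * y ^+ n + C / q ^+ 3 * (n.+1%:R * y ^+ n)))).
  apply: ler_sum => n _; rewrite mulrA -mulrDl ler_wpM2r ?exprn_ge0 //.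
  apply: le_trans (le_add_quartic _ q0) _; rewrite lerD2l [leRHS]mulrAC.
  by rewrite ler_wpM2r // invr_ge0 exprn_ge0 // ltW.
rewrite big_split /= -!mulr_sumr; apply: lerD.
  by rewrite ler_wpM2l ?geom_sum_le // ltW.
by rewrite ler_wpM2l ?sum_natmul_geom_le // divr_ge0 ?exprn_ge0 // ltW.
Qed.

(** * The real axis *)

(** On the real axis S and V are nonnegative, so S - V is the quotient of
    S^2 - V^2, which is O((1 - y)^(-1/2)), by S + V, which is at least of that
    order. The bound does not depend on y. *)
Lemma real_axis_bound (R : rcfType) (S V E P Z : {poly R}) (c C y : R) :
  0 < c -> 0 <= C -> 0 <= y < 1 ->
  S ^+ 2 = V ^+ 2 + 4 *: ((1 - 'X) * E) + ((1 - 'X) * P) ^+ 2 + Z ->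
  wnorm1 y Z <= 1 -> 0 <= S.[y] -> 0 <= V.[y] -> 2 * c / (1 - y) <= V.[y] ^+ 2 ->
  (forall n, E`_n ^+ 4 <= C * n.+1%:R) -> (forall n, P`_n ^+ 4 <= C * n.+1%:R) ->
  `|S.[y] - V.[y]| <= (4 * (1 + C) + (1 + C) ^+ 2 + 1) / Num.sqrt (2 * c).
Proof.
move=> c0 C0 y01 SE Zle S0 V0 Vge hE hP.
have [y0 y1] : 0 <= y /\ 0 < 1 - y by case/andP: y01; rewrite subr_gt0.
(* In terms of q = (1 - y)^(-1/4), the right-hand side of the identity is O(q^2)
   and V is at least of order q^2. *)
pose q := Num.sqrt (Num.sqrt (1 - y)^-1).
have N0 : 0 < (1 - y)^-1 by rewrite invr_gt0.
have q0 : 0 < q by rewrite !sqrtr_gt0.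
have q4 : q ^+ 4 = (1 - y)^-1.
  by rewrite (exprM _ 2 2) !sqr_sqrtr ?sqrtr_ge0 // ltW.
have q1 : 1 <= q.
  have : 1 <= q ^+ 4 by rewrite q4 invf_ge1 //; lra.
  by apply: contraTT; rewrite -!ltNge => ql; rewrite exprn_ilt1 // ltW.
have bE := wnorm1_le_quartic C0 y01 q0 q4 hE.
have bP := wnorm1_le_quartic C0 y01 q0 q4 hP.
have ev : S.[y] ^+ 2 = V.[y] ^+ 2 + 4 * ((1 - y) * E.[y]) + ((1 - y) * P.[y]) ^+ 2 + Z.[y].
  by rewrite -horner_exp SE !hornerE.
have E1 : `|(1 - y) * E.[y]| <= (1 + C) * q.
  by rewrite normrM (gtr0_norm y1); apply: le_trans bE; rewrite ler_pM2l // horner_le_wnorm1.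
have P1 : `|(1 - y) * P.[y]| <= (1 + C) * q.
  by rewrite normrM (gtr0_norm y1); apply: le_trans bP; rewrite ler_pM2l // horner_le_wnorm1.
have Z1 : `|Z.[y]| <= 1 by apply: le_trans Zle; exact: horner_le_wnorm1.
have s0 : 0 < Num.sqrt (2 * c) by rewrite sqrtr_gt0 mulr_gt0.
have Vq : Num.sqrt (2 * c) * q ^+ 2 <= V.[y].
  have sq0 : 0 <= Num.sqrt (2 * c) * q ^+ 2 by rewrite mulr_ge0 ?exprn_ge0 // ltW.
  have c20 : 0 <= 2 * c by rewrite mulr_ge0 // ltW.
  by rewrite -ler_sqr ?nnegrE // exprMn sqr_sqrtr // -exprM q4.
rewrite ler_pdivlMr //.
have q20 : 0 < q ^+ 2 by rewrite exprn_gt0.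
rewrite -(ler_pM2r q20) -mulrA.
apply: (@le_trans _ _ (`|S.[y] - V.[y]| * (S.[y] + V.[y]))).
  by rewrite ler_wpM2l //; apply: le_trans Vq _; rewrite lerDr.
rewrite -[X in _ * X]ger0_norm ?addr_ge0 // -normrM.
have -> : (S.[y] - V.[y]) * (S.[y] + V.[y]) =
    4 * ((1 - y) * E.[y]) + ((1 - y) * P.[y]) ^+ 2 + Z.[y].
  by rewrite -subr_sqr ev; ring.
apply: le_trans (ler_normD _ _) _.
apply: le_trans (lerD (ler_normD _ _) (lexx _)) _.
rewrite normrM (ger0_norm (ler0n _ 4)) normrX.
have C1 : 0 <= 1 + C by rewrite addr_ge0.
have P2 : `|(1 - y) * P.[y]| ^+ 2 <= (1 + C) ^+ 2 * q ^+ 2.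
  by rewrite -exprMn lerXn2r ?nnegrE // mulr_ge0 // ltW.
have q12 : q <= q ^+ 2 by rewrite expr2 ler_peMl // ltW.
have E2 : (1 + C) * q <= (1 + C) * q ^+ 2 by rewrite ler_wpM2l.
have q11 : 1 <= q ^+ 2 by apply: le_trans q1 q12.
lra.
Qed.

(** * Truncation of the series *)

(** The sequence of coefficients of y f(y), if f is the one of f(y). *)
Definition delay (V : nmodType) (f : nat -> V) (n : nat) : V :=
  if n is m.+1 then f m else 0.

Lemma coef_sqr_bound (R : numDomainType) (p : {poly R}) (K : R) (n : nat) :
  0 <= K -> (forall i, `|p`_i| <= K * i.+1%:R) ->
  `|(p ^+ 2)`_n| <= K ^+ 2 * n.+1%:R ^+ 3.
Proof.
move=> K0 pK; rewrite expr2 coefM; apply: le_trans (ler_norm_sum _ _ _) _.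
have -> : K ^+ 2 * n.+1%:R ^+ 3 = \sum_(i < n.+1) (K * n.+1%:R) * (K * n.+1%:R).
  rewrite sumr_const card_ord -mulr_natr; ring.
apply: ler_sum => i _; rewrite normrM.
apply: ler_pM => //; apply: le_trans (pK _) _; apply: ler_wpM2l => //.
  by rewrite ler_nat ltnS -ltnS.
by rewrite ler_nat ltnS leq_subr.
Qed.

Lemma coef_1subX_mul (R : nzRingType) (p : {poly R}) (n : nat) :
  ((1 - 'X) * p)`_n = p`_n - delay (nth 0 p) n.
Proof. by rewrite mulrBl mul1r coefB coefXM; case: n. Qed.

(** What truncating the four series at degree X adds to the identity between them;
    its coefficients vanish below X as soon as that identity holds for the series. *)
Definition tail_poly (R : comNzRingType) (s v E P : nat -> R) (X : nat) : {poly R} :=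
  (\poly_(n < X) s n) ^+ 2 - (\poly_(n < X) v n) ^+ 2
  - 4 *: ((1 - 'X) * \poly_(n < X) E n) - ((1 - 'X) * \poly_(n < X) P n) ^+ 2.

Lemma tail_polyE (R : comNzRingType) (s v E P : nat -> R) (X : nat) :
  (\poly_(n < X) s n) ^+ 2 = (\poly_(n < X) v n) ^+ 2
  + 4 *: ((1 - 'X) * \poly_(n < X) E n) + ((1 - 'X) * \poly_(n < X) P n) ^+ 2
  + tail_poly s v E P X.
Proof. by rewrite /tail_poly -!addrA; ring. Qed.

Lemma coef_tail_poly_eq0 (R : comNzRingType) (s v E P : nat -> R) (X n : nat) :
  (forall n, \sum_(i < n.+1) s i * s (n - i)%N =
     \sum_(i < n.+1) v i * v (n - i)%N + 4 * (E n - delay E n)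
     + \sum_(i < n.+1) (P i - delay P i) * (P (n - i)%N - delay P (n - i))) ->
  (n < X)%N -> (tail_poly s v E P X)`_n = 0.
Proof.
move=> sE nX; rewrite /tail_poly !coefB coefZ coef_1subX_mul !expr2 !coefM.
have iX (i : 'I_n.+1) : (i < X)%N by apply: leq_ltn_trans nX; rewrite -ltnS.
have niX (i : nat) : (n - i < X)%N by apply: leq_ltn_trans nX; exact: leq_subr.
have coefp f : \sum_(i < n.+1) (\poly_(m < X) f m)`_i * (\poly_(m < X) f m)`_(n - i)
    = \sum_(i < n.+1) f i * f (n - i)%N :> R.
  by apply: eq_bigr => i _; rewrite !coef_poly iX niX.
have prevp (f : nat -> R) m : (m < X)%N -> (\poly_(n < X) f n)`_m -
    delay (nth 0 (\poly_(n < X) f n)) m = f m - delay f m.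
  by case: m => [|m] mX; rewrite /= ?coef_poly ?mX // (ltnW mX).
rewrite !coefp prevp // sE.
under [X in _ - X]eq_bigr do rewrite !coef_1subX_mul !prevp //.
by ring.
Qed.

Lemma size_tail_poly (R : idomainType) (s v E P : nat -> R) (X : nat) :
  (size (tail_poly s v E P X) <= X.*2.+1)%N.
Proof.
have szp f : (size (\poly_(n < X) f n : {poly R}) <= X)%N by exact: size_poly.
have sz1 (p : {poly R}) : (size p <= X -> size ((1 - 'X) * p)%R <= X.+1)%N.
  move=> pX; apply: leq_trans (size_polyMleq _ _) _.
  by rewrite -opprB size_polyN size_XsubC /= ltnS.
have sz2 (p : {poly R}) : (size p <= X.+1 -> size (p ^+ 2)%R <= X.*2.+1)%N.
  move=> pX; rewrite expr2; apply: leq_trans (size_polyMleq _ _) _.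
  rewrite -addnn; lia.
have szB (p q : {poly R}) : (size p <= X.*2.+1 -> size q <= X.*2.+1 ->
    size (p - q)%R <= X.*2.+1)%N.
  by move=> pX qX; rewrite (leq_trans (size_polyD _ _)) // size_polyN geq_max pX.
rewrite /tail_poly; apply: (szB); last by rewrite sz2 ?sz1.
apply: (szB).
  by apply: (szB); apply: sz2; rewrite ltnW // ltnS.
apply: leq_trans (size_scale_leq _ _) _; apply: leq_trans (sz1 _ _) _ => //.
by rewrite ltnS -addnn leq_addr.
Qed.

Lemma coef_tail_poly_bound (R : numDomainType) (s v E P : nat -> R) (X : nat)
    (K : R) (n : nat) :
  1 <= K -> (forall n, `|s n| <= K * n.+1%:R) -> (forall n, `|v n| <= K * n.+1%:R) ->
  (forall n, `|E n| <= K * n.+1%:R) -> (forall n, `|P n| <= K * n.+1%:R) ->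
  `|(tail_poly s v E P X)`_n| <= 14 * K ^+ 2 * n.+1%:R ^+ 3.
Proof.
move=> K1 sK vK EK PK; have K0 : 0 <= K by exact: le_trans K1.
have polyK (f : nat -> R) : (forall n, `|f n| <= K * n.+1%:R) ->
    forall n, `|(\poly_(m < X) f m)`_n| <= K * n.+1%:R.
  by move=> fK m; rewrite coef_poly; case: ifP => // _; rewrite normr0 mulr_ge0.
have diffK (f : nat -> R) : (forall n, `|f n| <= K * n.+1%:R) ->
    forall n, `|((1 - 'X) * \poly_(m < X) f m)`_n| <= 2 * K * n.+1%:R.
  move=> /polyK fK m; rewrite coef_1subX_mul -mulrA mulr_natl mulr2n.
  apply: le_trans (ler_normB _ _) _; apply: lerD => //.
  case: m => [|m] /=; first by rewrite normr0 mulr_ge0.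
  by apply: le_trans (fK m) _; rewrite ler_wpM2l // ler_nat.
have n1 : n.+1%:R <= n.+1%:R ^+ 3 :> R by rewrite -natrX ler_nat -{1}[n.+1]expn1 leq_pexp2l.
have KK : K <= K ^+ 2 by rewrite expr2 ler_peMl.
have b1 := coef_sqr_bound n K0 (polyK _ sK).
have b2 := coef_sqr_bound n K0 (polyK _ vK).
have b3 : `|(4 *: ((1 - 'X) * \poly_(n < X) E n))`_n| <= 8 * K ^+ 2 * n.+1%:R ^+ 3.
  rewrite coefZ normrM ger0_norm //.
  apply: (@le_trans _ _ (4 * (2 * K * n.+1%:R))); first by rewrite ler_wpM2l ?diffK.
  have -> : 4 * (2 * K * n.+1%:R) = 8 * (K * n.+1%:R) by ring.
  by rewrite -[leRHS]mulrA ler_wpM2l // ler_pM.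
have b4 := coef_sqr_bound n (mulr_ge0 (ler0n _ 2) K0) (diffK _ PK).
(* 14 = 1 + 1 + 8 + 4, one term for each of the four parts. *)
rewrite /tail_poly !coefB.
apply: le_trans (ler_normB _ _) _.
apply: le_trans (lerD (ler_normB _ _) (lexx _)) _.
apply: le_trans (lerD (lerD (ler_normB _ _) (lexx _)) (lexx _)) _.
apply: le_trans (lerD (lerD (lerD b1 b2) b3) b4) _.
by rewrite le_eqVlt; apply/orP; left; apply/eqP; ring.
Qed.

Lemma wnorm1_mono (R : numDomainType) (p : {poly R}) (x y : R) :
  0 <= x <= y -> wnorm1 x p <= wnorm1 y p.
Proof.
move=> /andP[x0 xy]; apply: ler_sum => n _; rewrite ler_wpM2l // lerXn2r ?nnegrE //.
exact: le_trans xy.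
Qed.

Lemma wnorm1_tail_small (R : realType) (q K e : R) :
  0 <= q < 1 -> 0 <= K -> 0 < e -> exists X0, forall X (Z : {poly R}),
  (X0 <= X)%N -> (size Z <= X.*2.+1)%N -> (forall n, (n < X)%N -> Z`_n = 0) ->
  (forall n, `|Z`_n| <= K * n.+1%:R ^+ 3) -> wnorm1 q Z <= e.
Proof.
move=> q01 K0 e0; have [q0 q1] := andP q01.
(* The constants come from (2 X + 1)^4 <= 81 X^4 and 81 K <= 17 (16 K + 1). *)
have e1 : 0 < e / (16 * K + 1) / 17.
  by rewrite !divr_gt0 // ltr_wpDl // mulr_ge0.
have [m hm] := exp_mul_geom_small 4 q01 e1.
exists m.+1 => X Z mX szZ Z0 ZK.
have X0 : (0 < X)%N by exact: leq_trans mX.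
rewrite (wnorm1_wide _ szZ).
apply: (@le_trans _ _ (\sum_(n < X.*2.+1) K * (X.*2.+1)%:R ^+ 3 * q ^+ X)).
  apply: ler_sum => n _; have [nX|Xn] := ltnP n X.
    by rewrite Z0 // normr0 mul0r !mulr_ge0 ?exprn_ge0.
  apply: ler_pM => //; first exact: exprn_ge0.
    apply: le_trans (ZK _) _; rewrite ler_wpM2l // lerXn2r ?nnegrE // ler_nat.
    exact: ltn_ord.
  by apply: ler_wiXn2l => //; exact: ltW.
rewrite sumr_const card_ord -[_ *+ _]mulr_natr.
have -> : K * X.*2.+1%:R ^+ 3 * q ^+ X * X.*2.+1%:R = K * (X.*2.+1%:R ^+ 4 * q ^+ X).
  by ring.
have X3 : X.*2.+1%:R ^+ 4 <= (3 * X%:R) ^+ 4 :> R.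
  rewrite lerXn2r ?nnegrE ?mulr_ge0 // -natrM ler_nat; lia.
have := hm X (ltnW mX); set t := _ * q ^+ X => ht.
have t0 : 0 <= t by rewrite mulr_ge0 ?exprn_ge0.
apply: (@le_trans _ _ (K * (81 * t))).
  rewrite ler_wpM2l // /t mulrA ler_wpM2r ?exprn_ge0 //.
  by apply: le_trans X3 _; have -> : (3 * X%:R) ^+ 4 = 81 * X%:R ^+ 4 :> R by ring.
apply: (@le_trans _ _ (K * (81 * (e / (16 * K + 1) / 17)))).
  by rewrite !ler_wpM2l.
rewrite -subr_ge0.
have -> : e - K * (81 * (e / (16 * K + 1) / 17)) =
  e * (17 * (16 * K + 1) - 81 * K) / ((16 * K + 1) * 17).
  by field; rewrite gt_eqF //; lra.
by apply: divr_ge0; apply: mulr_ge0; lra.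
Qed.

(** * Windows *)

Lemma coef_geom_mul (R : nzRingType) (M : nat) (p : {poly R}) (n : nat) :
  (geom_poly R M * p)`_n = \sum_(j < M) if (j <= n)%N then p`_(n - j) else 0.
Proof.
rewrite /geom_poly mulr_suml coef_sum; apply: eq_bigr => j _.
by rewrite coefXnM ltnNge; case: (j <= n)%N.
Qed.

Lemma size_geom_mul (R : idomainType) (M X : nat) (p : {poly R}) :
  (size p <= X -> size (geom_poly R M * p)%R <= X + M)%N.
Proof.
move=> pX; rewrite /geom_poly mulr_suml; apply: (leq_trans (size_sum _ _ _)).
apply/bigmax_leqP => j _; apply: leq_trans (size_polyMleq _ _) _.
rewrite size_polyXn /= addnC leq_add // ltnW //.
Qed.

Lemma pairing_geom_mul (R : comNzRingType) (M X B : nat) (p : {poly R}) (f : nat -> R) :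
  (size p <= X)%N -> (X + M <= B)%N ->
  \sum_(n < B) (geom_poly R M * p)`_n * f n =
  \sum_(j < M) \sum_(m < size p) p`_m * f (m + j)%N.
Proof.
move=> pX XB.
under eq_bigr do rewrite coef_geom_mul mulr_suml.
rewrite exchange_big; apply: eq_bigr => j _ /=.
have jB : (j + size p <= B)%N.
  apply: leq_trans XB; rewrite addnC leq_add //; exact: ltnW.
rewrite -(subnKC jB) -addnA big_split_ord /= big1 ?add0r => [|n _]; last first.
  by rewrite leqNgt ltn_ord mul0r.
rewrite (sum_coef_wide (F := fun c m => c * f (m + j)%N) _ (leq_addr (B - (j + size p)) _)).
  by apply: eq_bigr => n _; rewrite leq_addr addKn (addnC j n).
by move=> n; rewrite mul0r.
Qed.

(** The left-hand side correlates the windows of D with M shifted copies of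
    central coefficients; each copy is an average of values of D. *)
Lemma window_moment (R : rcfType) (D : {poly R}) (M X : nat) (x C : R) :
  0 <= x <= 1 -> (size D <= X)%N -> (forall y, 0 <= y <= x -> `|D.[y]| <= C) ->
  `|\sum_(n < X + M) (geom_poly R M * D)`_n * (central_coef R (n + M) * x ^+ n)|
    <= M%:R * C.
Proof.
move=> /andP[x0 x1] DX DC.
rewrite (pairing_geom_mul (fun n => central_coef R (n + M) * x ^+ n) DX (leqnn _)).
apply: le_trans (ler_norm_sum _ _ _) _.
have -> : M%:R * C = \sum_(j < M) C by rewrite sumr_const card_ord mulr_natl.
apply: ler_sum => j _.
have -> : \sum_(m < size D) D`_m * (central_coef R (m + j + M) * x ^+ (m + j)) =
    x ^+ j * \sum_(m < size D) D`_m * central_coef R (m + (j + M)) * x ^+ m.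
  by rewrite mulr_sumr; apply: eq_bigr => m _; rewrite exprD addnA; ring.
have C0 : 0 <= C by apply: le_trans (normr_ge0 _) (DC 0 _); rewrite lexx.
rewrite normrM normrX ger0_norm // -[leRHS]mul1r; apply: ler_pM => //.
- exact: exprn_ge0.
- exact: exprn_ile1.
exact: central_coef_average.
Qed.

(** The sum telescopes, up to nonnegative terms of the right sign. *)
Lemma sum_shift_diff_le (R : numDomainType) (f : nat -> R) (L B : nat) :
  (forall n, 0 <= f n) ->
  \sum_(n < B) (f n - f (n + L)%N) <= \sum_(n < L) f n.
Proof.
move=> f0; rewrite sumrB lerBlDr.
have -> : \sum_(n < L) f n + \sum_(n < B) f (n + L)%N = \sum_(n < L + B) f n.
  by rewrite big_split_ord /=; congr (_ + _); apply: eq_bigr => n _; rewrite addnC.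
by rewrite addnC big_split_ord /= lerDl sumr_ge0.
Qed.

(** Central coefficients decrease: the window with the largest sum starts at 0. *)
Lemma window_central_le (R : realFieldType) (M n : nat) :
  \sum_(j < M) (if (j <= n)%N then central_coef R (n - j) else 0) <=
  M.*2%:R * central_coef R M.
Proof.
rewrite -sum_central_coef.
have [nM|Mn] := leqP n.+1 M.
  rewrite -(subnKC nM) big_split_ord /= [X in _ + X]big1 ?addr0 => [|j _]; last first.
    by rewrite leqNgt leq_addr.
  rewrite (reindex_inj rev_ord_inj) /= big_split_ord /=.
  under eq_bigr => j _ do rewrite subSS leq_subr subKn -1?ltnS //.
  by rewrite lerDl sumr_ge0 // => j _; rewrite ltW ?central_coef_gt0.
rewrite [leRHS](reindex_inj rev_ord_inj) /=; apply: ler_sum => j _.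
have jn : (j <= n)%N by apply: leq_trans (ltnW (ltn_ord j)) _.
by rewrite jn; apply: central_coef_anti; move: (ltn_ord j); lia.
Qed.

(** A window of M central coefficients ending at n is replaced by M copies of the
    single coefficient at n + M. The shift by M avoids the singularity of
    n^(-1/2) at 0, which would cost a logarithm; and the replacement is by
    moments, to which averaging over the real axis applies. *)
Lemma window_approx (R : realFieldType) (M X : nat) :
  \sum_(n < X + M) (M%:R * central_coef R (n + M)
     - (geom_poly R M * \poly_(n < X) central_coef R n)`_n) ^+ 2
  <= 10 * M%:R ^+ 2.
Proof.
set g := central_coef R; pose w n := (geom_poly R M * \poly_(i < X) g i)`_n.
pose W n := \sum_(j < M) (if (j <= n)%N then g (n - j)%N else 0).
pose K := M.*2%:R * g M.
have g0 n : 0 <= g n by rewrite ltW ?central_coef_gt0.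
have K0 : 0 <= K by rewrite mulr_ge0.
under eq_bigr do rewrite -/(w _).
have K2 : K ^+ 2 <= 2 * M%:R.
  have := sqr_central_coef_le R M; rewrite -/(g M) -natr1 => h.
  have -> : 2 * M%:R = M.*2%:R :> R by rewrite -natrM mul2n.
  rewrite /K; move: h; have : 0 <= M.*2%:R :> R by [].
  move: (M.*2%:R : R) (g M) => t a t0; rewrite mulrDl mul1r exprMn expr2 => h.
  rewrite -mulrA ler_piMr //; apply: le_trans h; rewrite lerDl; exact: sqr_ge0.
have wE n : (n < X)%N -> w n = W n.
  move=> nX; rewrite /w coef_geom_mul; apply: eq_bigr => j _; case: ifP => // jn.
  by rewrite coef_poly (leq_ltn_trans _ nX) ?leq_subr.
have w0 n : 0 <= w n.
  rewrite /w coef_geom_mul sumr_ge0 // => j _; case: ifP => // _.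
  by rewrite coef_poly; case: ifP.
have wK n : w n <= K.
  apply: le_trans (window_central_le R M n); rewrite /w coef_geom_mul.
  apply: ler_sum => j _; case: ifP => // _; rewrite coef_poly; case: ifP => // _.
have gM n : (M <= n)%N -> M%:R * g n <= K.
  by move=> Mn; apply: ler_pM; rewrite ?central_coef_anti // ler_nat -addnn leq_addr.
have uwK n : `|M%:R * g (n + M)%N - w n| <= K.
  have u0 : 0 <= M%:R * g (n + M)%N by rewrite mulr_ge0.
  have := gM _ (leq_addl n M); have := w0 n; have := wK n.
  by rewrite ler_norml => *; lra.
(* The two sides are at distance at most K pointwise, which reduces the sum of
   squares to a sum of absolute values; that one telescopes. *)
have sqK n : (M%:R * g (n + M)%N - w n) ^+ 2 <= K * `|M%:R * g (n + M)%N - w n|.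
  by rewrite -real_normK ?num_real // expr2 ler_wpM2r.
have l1 : \sum_(n < X) `|M%:R * g (n + M)%N - w n| <= M%:R * (4 * K).
  apply: (@le_trans _ _ (\sum_(n < X) \sum_(j < M)
      `|g (n + M)%N - (if (j <= n)%N then g (n - j)%N else 0)|)).
    apply: ler_sum => n _; rewrite wE // /W.
    have -> : M%:R * g (n + M)%N = \sum_(j < M) g (n + M)%N.
      by rewrite sumr_const card_ord mulr_natl.
    by rewrite -sumrB; apply: ler_norm_sum.
  rewrite exchange_big /=.
  have -> : M%:R * (4 * K) = \sum_(j < M) (4 * K) by rewrite sumr_const card_ord mulr_natl.
  apply: ler_sum => j _.
  have jM : \sum_(n < j + M) g n <= 2 * K.
    rewrite sum_central_coef; have -> : 2 * K = (M.*2.*2)%:R * g M.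
      by rewrite /K mulrA -natrM mul2n.
    apply: ler_pM => //; last by rewrite central_coef_anti // leq_addl.
    by rewrite ler_nat leq_double -addnn leq_add2r ltnW.
  apply: (@le_trans _ _ (\sum_(n < j + X)
      `|g (n + M)%N - (if (j <= n)%N then g (n - j)%N else 0)|)).
    by rewrite addnC big_split_ord /= lerDl sumr_ge0.
  have -> : 4 * K = 2 * K + 2 * K by ring.
  rewrite big_split_ord /=; apply: lerD.
    apply: le_trans jM; rewrite addnC big_split_ord /=.
    apply: ler_wpDl; first exact: sumr_ge0.
    apply: ler_sum => n _; rewrite leqNgt ltn_ord /= subr0 ger0_norm //.
    by rewrite addnC.
  apply: le_trans jM; apply: le_trans (sum_shift_diff_le (j + M) X g0).
  apply: ler_sum => n _; rewrite leq_addr addKn distrC (addnC j n) addnA ger0_norm //.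
  by rewrite subr_ge0 central_coef_anti // -addnA leq_addr.
rewrite big_split_ord /=.
apply: (@le_trans _ _ (K * (M%:R * (4 * K)) + M%:R * K ^+ 2)).
  apply: lerD.
    apply: le_trans (ler_sum _ (fun (n : 'I_X) _ => sqK n)) _.
    by rewrite -mulr_sumr ler_wpM2l.
  have -> : M%:R * K ^+ 2 = \sum_(n < M) K ^+ 2 by rewrite sumr_const card_ord mulr_natl.
  apply: ler_sum => n _; apply: le_trans (sqK _) _.
  by rewrite expr2 ler_wpM2l.
have -> : K * (M%:R * (4 * K)) + M%:R * K ^+ 2 = 5 * M%:R * K ^+ 2 by ring.
have -> : 10 * M%:R ^+ 2 = 5 * M%:R * (2 * M%:R) :> R by ring.
by rewrite ler_wpM2l // mulr_ge0.
Qed.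

Lemma coef_geom_mul_nat (R : nzRingType) (M X : nat) (s : nat -> nat) (n : nat) :
  (geom_poly R M * \poly_(i < X) (s i)%:R)`_n =
  (\sum_(j < M) if (j <= n)%N then (if (n - j < X)%N then s (n - j)%N else 0%N) else 0%N)%:R.
Proof.
rewrite coef_geom_mul natr_sum; apply: eq_bigr => j _.
by case: (j <= n)%N => //; rewrite coef_poly; case: (_ < X)%N.
Qed.

(** With w the windows of S, v those of the model V and u the approximation of v by
    shifted coefficients, w^2 - v^2 = 2 u (w - v) - (u - v)^2 + (w - u)^2. The
    first term has a bounded correlation sum, the second one is small in mean
    square, and the third one is where integrality of w is felt. *)
Lemma window_energy_gain (R : rcfType) (s : nat -> nat) (a x C : R) (M X n0 : nat) :
  0 <= x <= 1 -> 0 <= a ->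
  (forall y, 0 <= y <= x ->
     `|(\poly_(n < X) (s n)%:R).[y] - (a *: \poly_(n < X) central_coef R n).[y]| <= C) ->
  (forall n, (n0 <= n)%N -> M%:R * a * central_coef R (n + M) <= 4^-1) ->
  2^-1 * (\sum_(n < X + M) if (n0 <= n)%N
      then (geom_poly R M * \poly_(n < X) (s n)%:R)`_n * x ^+ n else 0) <=
  wnorm2 x (geom_poly R M * \poly_(n < X) (s n)%:R)
  - wnorm2 x (geom_poly R M * (a *: \poly_(n < X) central_coef R n))
  + 2 * a * C * M%:R ^+ 2 + 10 * a ^+ 2 * M%:R ^+ 2.
Proof.
move=> x01 a0 DC ule; have [x0 x1] := andP x01.
set S := \poly_(n < X) (s n)%:R; set G := \poly_(n < X) central_coef R n.
set h := geom_poly R M.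
have szS : (size S <= X)%N by exact: size_poly.
have szG : (size G <= X)%N by exact: size_poly.
have szaG : (size (a *: G) <= X)%N by apply: leq_trans (size_scale_leq _ _) _.
pose u n := M%:R * a * central_coef R (n + M).
pose w n := (h * S)`_n; pose v n := (h * (a *: G))`_n.
have szD : (size (S - a *: G)%R <= X)%N.
  by apply: leq_trans (size_polyD _ _) _; rewrite size_polyN geq_max szS.
have mom : - (M%:R * a * (M%:R * C)) <= \sum_(n < X + M) u n * (w n - v n) * x ^+ n.
  have := window_moment M x01 szD (C := C).
  have DC' y : 0 <= y <= x -> `|(S - a *: G).[y]| <= C.
    by move=> yx; rewrite hornerD hornerN; exact: DC.
  move=> /(_ DC'); rewrite ler_norml => /andP[+ _] => lo.
  have -> : \sum_(n < X + M) u n * (w n - v n) * x ^+ n = M%:R * a *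
     \sum_(n < X + M) (h * (S - a *: G))`_n * (central_coef R (n + M) * x ^+ n).
    by rewrite mulr_sumr; apply: eq_bigr => n _; rewrite [h * _]mulrBr coefB /u /w /v; ring.
  by rewrite -mulrN; apply: ler_wpM2l lo; rewrite mulr_ge0.
have apx : \sum_(n < X + M) (u n - v n) ^+ 2 * x ^+ n <= 10 * a ^+ 2 * M%:R ^+ 2.
  have -> : 10 * a ^+ 2 * M%:R ^+ 2 = a ^+ 2 * (10 * M%:R ^+ 2) by ring.
  apply: le_trans (ler_wpM2l (sqr_ge0 a) (window_approx R M X)).
  rewrite mulr_sumr; apply: ler_sum => n _.
  have -> : u n - v n = a * (M%:R * central_coef R (n + M) - (h * G)`_n).
    by rewrite /u /v -mul_polyC [h * _]mulrCA coefCM; ring.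
  rewrite exprMn; apply: ler_piMr; last exact: exprn_ile1.
  by rewrite mulr_ge0 ?sqr_ge0.
(* Past n0 the window count w n is an integer while u n <= 1/4, hence
   (w n - u n) ^ 2 >= w n / 2: an integer stays away from small numbers. *)
have exc n : (if (n0 <= n)%N then w n * x ^+ n else 0) / 2 <=
    (w n ^+ 2 - v n ^+ 2 - 2 * (u n * (w n - v n)) + (u n - v n) ^+ 2) * x ^+ n.
  have -> : w n ^+ 2 - v n ^+ 2 - 2 * (u n * (w n - v n)) + (u n - v n) ^+ 2 =
    (w n - u n) ^+ 2 by ring.
  case: ifP => [n0n|_]; last by rewrite mul0r mulr_ge0 ?sqr_ge0 ?exprn_ge0.
  rewrite mulrAC ler_wpM2r ?exprn_ge0 //.
  have := ule n n0n; rewrite -/(u n) /w coef_geom_mul_nat.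
  have u0 : 0 <= u n by apply: mulr_ge0; [exact: mulr_ge0 | exact: ltW (central_coef_gt0 R _)].
  case: (\sum_(j < M) _)%N => [|k] u4; first by rewrite mul0r sqr_ge0.
  have k1 : 1 <= k.+1%:R :> R by rewrite ler1n.
  move: (k.+1%:R : R) k1 => t t1; nra.
have := ler_sum (index_enum 'I_(X + M)) (P := xpredT) (fun n _ => exc n).
rewrite -mulr_suml mulrC => H.
have szle (p : {poly R}) : (size p <= X)%N -> (size (h * p)%R <= X + M)%N by exact: size_geom_mul.
rewrite (wnorm2_wide _ (szle _ szS)) (wnorm2_wide _ (szle _ szaG)).
apply: le_trans H _.
have -> : \sum_(n < X + M) (w n ^+ 2 - v n ^+ 2 - 2 * (u n * (w n - v n)) + (u n - v n) ^+ 2) * x ^+ n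
  = \sum_(n < X + M) w n ^+ 2 * x ^+ n - \sum_(n < X + M) v n ^+ 2 * x ^+ n
    - 2 * (\sum_(n < X + M) u n * (w n - v n) * x ^+ n)
    + \sum_(n < X + M) (u n - v n) ^+ 2 * x ^+ n.
  rewrite mulr_sumr -!sumrB -big_split /=; apply: eq_bigr => n _; ring.
by rewrite -/w -/v; nra.
Qed.

(** The total mass of the windows is the product of values at x; the indices below
    n0 cannot carry more than M times the number of elements below n0. *)
Lemma window_mass (R : realFieldType) (s : nat -> nat) (x : R) (M X n0 : nat) :
  0 <= x <= 1 -> (n0 <= X)%N ->
  (geom_poly R M).[x] * (\poly_(n < X) (s n)%:R).[x] - M%:R * \sum_(m < n0) (s m)%:R <=
  \sum_(n < X + M) if (n0 <= n)%N
      then (geom_poly R M * \poly_(n < X) (s n)%:R)`_n * x ^+ n else 0.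
Proof.
move=> /andP[x0 x1] n0X; rewrite lerBlDr -hornerM.
set S := \poly_(n < X) (s n)%:R; set h := geom_poly R M.
have szS : (size (h * S)%R <= X + M)%N by apply: size_geom_mul; exact: size_poly.
rewrite (horner_coef_wide _ szS).
have small : \sum_(n < n0) (h * S)`_n <= M%:R * \sum_(m < n0) (s m)%:R.
  under eq_bigr do rewrite coef_geom_mul.
  rewrite exchange_big /=.
  have -> : M%:R * (\sum_(m < n0) (s m)%:R) = \sum_(j < M) \sum_(m < n0) (s m)%:R :> R.
    by rewrite sumr_const card_ord mulr_natl.
  apply: ler_sum => j _.
  apply: (@le_trans _ _ (\sum_(n < j + n0) if (j <= n)%N then S`_(n - j) else 0)).
    rewrite addnC big_split_ord /= lerDl sumr_ge0 // => i _; case: ifP => // _.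
    by rewrite coef_poly; case: ifP.
  rewrite big_split_ord /= big1 ?add0r => [|i _]; last by rewrite leqNgt ltn_ord.
  apply: ler_sum => i _; rewrite leq_addr addKn coef_poly.
  by case: ifP.
apply: (@le_trans _ _ (\sum_(n < X + M) (if (n0 <= n)%N then (h * S)`_n * x ^+ n else 0)
   + \sum_(n < X + M) (if (n < n0)%N then (h * S)`_n else 0))).
  rewrite -big_split /=; apply: ler_sum => n _.
  case: ltnP => _; rewrite ?add0r ?addr0 // ler_piMr ?exprn_ile1 //.
  by rewrite coef_geom_mul_nat.
rewrite lerD2l; apply: le_trans small.
rewrite [leRHS](big_ord_widen (X + M) (fun n => (h * S)`_n)).
  by rewrite [leRHS]big_mkcond.
exact: leq_trans n0X (leq_addr _ _).
Qed.

Lemma sqr_central_poly_ge (R : realFieldType) (X : nat) (y : R) :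
  0 <= y -> \sum_(n < X) y ^+ n <= (\poly_(n < X) central_coef R n).[y] ^+ 2.
Proof.
move=> y0; set G := \poly_(n < X) _; rewrite -horner_exp.
have szG : (size (G ^+ 2)%R <= X.*2)%N.
  rewrite expr2; apply: leq_trans (size_polyMleq _ _) _.
  by rewrite -addnn; apply: leq_trans (leq_pred _) _; rewrite leq_add ?size_poly.
rewrite (horner_coef_wide _ szG) -addnn big_split_ord /=.
apply: ler_wpDr.
  apply: sumr_ge0 => n _; rewrite mulr_ge0 ?exprn_ge0 // expr2 coefM sumr_ge0 // => i _.
  by rewrite !coef_poly mulr_ge0 //; case: ifP => // _; rewrite ltW ?central_coef_gt0.
apply: ler_sum => n _; rewrite expr2 coefM -[leLHS]mul1r.
rewrite ler_wpM2r ?exprn_ge0 // -(central_coef_convolution R n) le_eqVlt.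
apply/orP; left; apply/eqP/eq_bigr => i _; rewrite !coef_poly.
have nX := ltn_ord n.
by rewrite !ifT // (leq_ltn_trans _ nX) ?leq_subr // -ltnS.
Qed.

Lemma sqr_central_poly_le (R : realFieldType) (X : nat) (y : R) :
  0 <= y < 1 -> (\poly_(n < X) central_coef R n).[y] ^+ 2 <= (1 - y)^-1.
Proof.
move=> y01; have [y0 _] := andP y01; set G := \poly_(n < X) _; rewrite -horner_exp.
rewrite horner_coef; apply: le_trans (geom_sum_le _ y01).
apply: ler_sum => n _; rewrite -[leRHS]mul1r ler_wpM2r ?exprn_ge0 //.
move: (nat_of_ord n) => {}n.
rewrite expr2 coefM -(central_coef_convolution R n); apply: ler_sum => i _.
have g0 m : 0 <= central_coef R m by rewrite ltW ?central_coef_gt0.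
have gle m : G`_m <= central_coef R m by rewrite coef_poly; case: ifP.
by apply: ler_pM => //; rewrite coef_poly; case: ifP.
Qed.

(** * Contradiction between the scales *)

Lemma poly_scale (R : nzRingType) (a : R) (f : nat -> R) (X : nat) :
  \poly_(n < X) (a * f n) = a *: \poly_(n < X) f n.
Proof. by apply/polyP => n; rewrite coefZ !coef_poly; case: ifP => // _; rewrite mulr0. Qed.

Lemma horner_poly_ge0 (R : numDomainType) (f : nat -> R) (X : nat) (y : R) :
  (forall n, 0 <= f n) -> 0 <= y -> 0 <= (\poly_(n < X) f n).[y].
Proof.
move=> f0 y0; rewrite horner_coef sumr_ge0 // => n _.
by rewrite mulr_ge0 ?exprn_ge0 // coef_poly; case: ifP.
Qed.

Lemma wnorm2_poly (R : nzRingType) (x : R) (f : nat -> R) (X : nat) :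
  wnorm2 x (\poly_(n < X) f n) = \sum_(n < X) f n ^+ 2 * x ^+ n.
Proof.
rewrite (wnorm2_wide _ (size_poly _ _)); apply: eq_bigr => n _.
by rewrite coef_poly ltn_ord.
Qed.

(** The constant in the last bound does not depend on q: only the degree of the
    truncation does. *)
Lemma axis_control (R : realType) (s : nat -> nat) (E P : nat -> R) (c C q : R) :
  0 < c -> 0 <= C -> 0 <= q < 1 -> (forall n, (s n <= 2)%N) ->
  (forall n, \sum_(i < n.+1) (s i)%:R * (s (n - i)%N)%:R =
     4 * c + 4 * (E n - delay E n)
     + \sum_(i < n.+1) (P i - delay P i) * (P (n - i)%N - delay P (n - i))) ->
  (forall n, E n ^+ 4 <= C * n.+1%:R) -> (forall n, P n ^+ 4 <= C * n.+1%:R) ->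
  exists X0, forall X, (X0 <= X)%N ->
    wnorm1 q (tail_poly (fun n => (s n)%:R)
      (fun n => 2 * Num.sqrt c * central_coef R n) E P X) <= 1 /\
    forall y, 0 <= y <= q ->
      2 * c / (1 - y) <= ((2 * Num.sqrt c) *: \poly_(n < X) central_coef R n).[y] ^+ 2 /\
      `|(\poly_(n < X) (s n)%:R).[y]
          - ((2 * Num.sqrt c) *: \poly_(n < X) central_coef R n).[y]|
        <= (4 * (1 + C) + (1 + C) ^+ 2 + 1) / Num.sqrt (2 * c).
Proof.
move=> c0 C0 q01 s2 conv EC PC; have [q0 q1] := andP q01.
set a := 2 * Num.sqrt c; have a0 : 0 < a by rewrite mulr_gt0 // sqrtr_gt0.
have a2 : a ^+ 2 = 4 * c by rewrite exprMn sqr_sqrtr ?(ltW c0) // -natrX.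
set Z := tail_poly _ _ _ _.
pose K := 2 + a + C.
have K2 : 2 <= K by rewrite /K -addrA lerDl addr_ge0 // ltW.
have n1 n : 1 <= n.+1%:R :> R by rewrite ler1n.
have quartic f : (forall n, f n ^+ 4 <= C * n.+1%:R) ->
    forall n, `|f n| <= K * n.+1%:R.
  move=> fC n; apply: le_trans (le_add_quartic (f n) ltr01) _.
  rewrite expr1n divr1 /K; have := fC n; have := n1 n; nra.
have sK n : `|(s n)%:R| <= K * n.+1%:R :> R.
  rewrite ger0_norm //; have : (s n)%:R <= 2 :> R by rewrite ler_nat.
  have := n1 n; nra.
have vK n : `|a * central_coef R n| <= K * n.+1%:R.
  have g0 := central_coef_gt0 R n.
  have : central_coef R n <= 1 by rewrite -(central_coef0 R) central_coef_anti.
  have ag0 : 0 <= a * central_coef R n by apply: mulr_ge0; exact: ltW.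
  rewrite ger0_norm // => g1; have := n1 n; rewrite /K; nra.
have conv' n : \sum_(i < n.+1) (s i)%:R * (s (n - i)%N)%:R =
    \sum_(i < n.+1) (a * central_coef R i) * (a * central_coef R (n - i))
    + 4 * (E n - delay E n)
    + \sum_(i < n.+1) (P i - delay P i) * (P (n - i)%N - delay P (n - i)).
  rewrite conv -a2 -[in LHS](mulr1 (a ^+ 2)) -(central_coef_convolution R n) mulr_sumr.
  by congr (_ + _ + _); apply: eq_bigr => i _; ring.
have K14 : 0 <= 14 * K ^+ 2 by rewrite mulr_ge0 ?sqr_ge0.
have [X1 hX1] := wnorm1_tail_small q01 K14 ltr01.
have half0 : (0 : R) < 2^-1 by rewrite invr_gt0.
have [X2 hX2] := exp_mul_geom_small 0 q01 half0.
exists (maxn X1 X2) => X; rewrite geq_max => /andP[X1X X2X].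
have Zq : wnorm1 q (Z X) <= 1.
  apply: (hX1 X) => //; first exact: size_tail_poly.
    by move=> n nX; apply: coef_tail_poly_eq0.
  move=> n; apply: coef_tail_poly_bound => //; [lra|exact: quartic|exact: quartic].
split=> // y /andP[y0 yq].
have y1 : y < 1 by exact: le_lt_trans q1.
set S := \poly_(n < X) (s n)%:R; set V := a *: _.
have V2 : 2 * c / (1 - y) <= V.[y] ^+ 2.
  rewrite /V hornerZ exprMn a2.
  apply: le_trans (ler_wpM2l _ (sqr_central_poly_ge X y0)); last by rewrite mulr_ge0 // ltW.
  have yX : y ^+ X <= 2^-1.
    have := hX2 X X2X; rewrite expr0 mul1r; apply: le_trans.
    by rewrite lerXn2r ?nnegrE.
  have e : (1 - y) * (\sum_(n < X) y ^+ n) = 1 - y ^+ X.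
    by rewrite -opprB mulNr -subrX1 opprB.
  rewrite ler_pdivrMr ?subr_gt0 // -mulrA [_ * (1 - y)]mulrC e.
  have : c * y ^+ X <= c * 2^-1 by rewrite ler_pM2l.
  lra.
have S0 : 0 <= S.[y] by exact: horner_poly_ge0.
have V0 : 0 <= V.[y].
  rewrite hornerZ; apply: mulr_ge0; first exact: ltW.
  by apply: horner_poly_ge0 => // n; rewrite ltW ?central_coef_gt0.
have polyC (f : nat -> R) : (forall n, f n ^+ 4 <= C * n.+1%:R) ->
    forall n, (\poly_(m < X) f m)`_n ^+ 4 <= C * n.+1%:R.
  by move=> fC n; rewrite coef_poly; case: ifP => // _; rewrite expr0n mulr_ge0.
split=> //.
apply: (@real_axis_bound R S V (\poly_(n < X) E n) (\poly_(n < X) P n) (Z X) c C y) => //.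
- by rewrite y0 y1.
- by rewrite /S /V -poly_scale; exact: tail_polyE.
- by apply: le_trans Zq; apply: wnorm1_mono; rewrite y0.
- exact: polyC.
- exact: polyC.
Qed.

Lemma sum_sqr_le_cube (R : realFieldType) (f : nat -> R) (d l C x : R) (X : nat) :
  0 < d -> 0 < l -> 0 <= x < 1 -> (1 - x)^-1 = l ^+ 2 ->
  0 <= C <= d ^+ 2 * l ^+ 2 ->
  (forall n, f n ^+ 4 <= d ^+ 2 * n.+1%:R + C) ->
  \sum_(n < X) f n ^+ 2 * x ^+ n <= 2 * d * l ^+ 3.
Proof.
move=> d0 l0 x01 xl /andP[C0 Cdl] fC.
apply: le_trans (sum_sqr_le_quartic X (mulr_gt0 d0 l0) (sqr_ge0 d) C0 x01 fC) _.
rewrite -exprVn xl.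
apply: (@le_trans _ _ ((d * l * l ^+ 2 +
    (d ^+ 2 * (l ^+ 2) ^+ 2 + (d ^+ 2 * l ^+ 2) * l ^+ 2) / (d * l)) / 2)).
  rewrite ler_pM2r ?invr_gt0 // lerD2l ler_pM2r ?invr_gt0 ?mulr_gt0 // lerD2l.
  by rewrite ler_pM2r ?exprn_gt0.
have -> : (d * l * l ^+ 2 +
    (d ^+ 2 * (l ^+ 2) ^+ 2 + (d ^+ 2 * l ^+ 2) * l ^+ 2) / (d * l)) / 2
    = 3 / 2 * (d * l ^+ 3) by field; rewrite !gt_eqF.
have : 0 < d * l ^+ 3 by apply: mulr_gt0 => //; exact: exprn_gt0.
lra.
Qed.

(** Half of the decay of x^n absorbs the growth of the square root. *)
Lemma sqrt_weight_le (R : rcfType) (d l C x q : R) (n : nat) :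
  0 < d -> 1 <= l -> 0 <= x <= q ^+ 2 -> 0 <= q < 1 -> (1 - q)^-1 = 2 * l ^+ 2 ->
  0 <= C <= d ^+ 2 * l ^+ 2 ->
  Num.sqrt (d ^+ 2 * n.+1%:R + C) * x ^+ n <= 3 * d * l * q ^+ n.
Proof.
move=> d0 l1 /andP[x0 xq] q01 ql /andP[C0 Cdl]; have [q0 q1] := andP q01.
have l0 : 0 < l by apply: lt_le_trans l1.
set z := d ^+ 2 * n.+1%:R + C.
have z0 : 0 <= z.
  by apply: addr_ge0 => //; apply: mulr_ge0 => //; exact: sqr_ge0.
have sq : Num.sqrt z <= d * l + d * n.+1%:R / (2 * l).
  have h := sqr_le_add_quartic (Num.sqrt (Num.sqrt z)) (mulr_gt0 d0 l0).
  rewrite (exprM _ 2 2) !sqr_sqrtr ?sqrtr_ge0 // in h.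
  apply: le_trans h _.
  apply: (@le_trans _ _ ((d * l + (d ^+ 2 * n.+1%:R + d ^+ 2 * l ^+ 2) / (d * l)) / 2)).
    by rewrite ler_pM2r ?invr_gt0 // lerD2l ler_pM2r ?invr_gt0 ?mulr_gt0 // lerD2l.
  rewrite le_eqVlt; apply/orP; left; apply/eqP; field; rewrite !gt_eqF //.
have nq : n.+1%:R * q ^+ n <= 3 * l ^+ 2.
  have := natmul_geom_le n q01; rewrite ql => h.
  have qn : q ^+ n <= 1 by rewrite exprn_ile1 // ltW.
  have l2 : 1 <= l ^+ 2 by rewrite exprn_ege1.
  rewrite -natr1 mulrDl mul1r; lra.
have xn : x ^+ n <= q ^+ n * q ^+ n.
  by rewrite -expr2 exprAC lerXn2r ?nnegrE ?exprn_ge0.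
have qn0 : 0 <= q ^+ n by rewrite exprn_ge0.
have qn1 : q ^+ n <= 1 by rewrite exprn_ile1 // ltW.
apply: (@le_trans _ _ ((d * l + d * n.+1%:R / (2 * l)) * (q ^+ n * q ^+ n))).
  by apply: ler_pM; rewrite ?sqrtr_ge0 ?exprn_ge0.
rewrite mulrA ler_wpM2r // mulrDl.
have b1 : d * l * q ^+ n <= d * l by rewrite ler_piMr // ltW ?mulr_gt0.
have b2 : d * n.+1%:R / (2 * l) * q ^+ n <= 3 / 2 * (d * l).
  have -> : d * n.+1%:R / (2 * l) * q ^+ n = d / (2 * l) * (n.+1%:R * q ^+ n) by ring.
  apply: le_trans (ler_wpM2l _ nq) _; first by rewrite divr_ge0 ?mulr_ge0 ?ltW.
  rewrite le_eqVlt; apply/orP; left; apply/eqP; field; rewrite !gt_eqF //.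
have : 0 < d * l by rewrite mulr_gt0.
lra.
Qed.

(** The main term b L M^2 / 2 is compared with errors K M^2. *)
Lemma scale_contradiction (R : realFieldType) (a b D K B k L M : R) (w : R) :
  0 <= a -> 0 <= D -> 0 <= k -> 1 <= M -> 0 <= w ->
  B = K + D + 2 * a * k + D -> 4 * B < b * L ->
  M / 2 * (b * (L * M) - D) - M * (2 * (a * (2 * k * M) + D)) <= 2 * w ->
  w <= K * M ^+ 2 -> False.
Proof.
move=> a0 D0 k0 M1 w0 -> bL h wK.
have M0 : 0 < M by exact: lt_le_trans M1.
have DM : D * M <= D * M ^+ 2 by rewrite ler_wpM2l // expr2 ler_peMl // ltW.
have : M ^+ 2 * (4 * (K + D + 2 * a * k + D)) < M ^+ 2 * (b * L).
  by rewrite ltr_pM2l ?exprn_gt0.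
have DM0 : 0 <= D * M by rewrite mulr_ge0 // ltW.
lra.
Qed.

(** The analytic core, where s is meant to be the sum of two indicators, P the
    difference of their counting functions, and E the error in counting pairs.
    The last hypothesis expresses that the mean square of P is controlled by the
    mass of s at the scale n^(1/2): every index where P is nonzero is paid for by
    an element nearby. On the circle of radius sqrt x with 1 - x = (L M)^(-2), the
    windows of length M gain b L M^2 / 4 over the model, up to O(M^2), against
    errors that are O(M^2) uniformly in L once M is large. *)
Lemma no_linear_asymptotics (R : realType) (s : nat -> nat) (E P : nat -> R) (c : R) :
  0 < c -> (forall n, (s n <= 2)%N) ->
  (forall n, \sum_(i < n.+1) (s i)%:R * (s (n - i)%N)%:R =
     4 * c + 4 * (E n - delay E n)
     + \sum_(i < n.+1) (P i - delay P i) * (P (n - i)%N - delay P (n - i))) ->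
  (forall e, 0 < e -> exists C, forall n, E n ^+ 4 <= e * n.+1%:R + C) ->
  (exists C, forall n, P n ^+ 4 <= C * n.+1%:R) ->
  (forall e, 0 < e -> exists2 C, 0 <= C & forall X x, 0 <= x <= 1 ->
     \sum_(n < X) P n ^+ 2 * x ^+ n <=
     \sum_(n < X) (s n)%:R * (Num.sqrt (e * n.+1%:R + C) * x ^+ n)) ->
  False.
Proof.
move=> c0 s2 conv Eo [CP hCP] Po.
have [CE hCE] := Eo 1 ltr01.
pose C1 := 1 + `|CE| + `|CP|.
have n1 n : 1 <= n.+1%:R :> R by rewrite ler1n.
have C10 : 0 <= C1 by rewrite !addr_ge0.
have EC n : E n ^+ 4 <= C1 * n.+1%:R.
  apply: le_trans (hCE n) _; rewrite /C1 -addrA mulrDl lerD2l.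
  have : CE <= `|CE| by exact: ler_norm.
  have : 0 <= `|CP| by []. have := n1 n; have : 0 <= `|CE| by []. nra.
have PC n : P n ^+ 4 <= C1 * n.+1%:R.
  apply: le_trans (hCP n) _; rewrite ler_wpM2r // /C1.
  by apply: le_trans (ler_norm _) _; rewrite lerDr addr_ge0.
have axis q := fun q01 => @axis_control R s E P c C1 q c0 C10 q01 s2 conv EC PC.
set a := 2 * Num.sqrt c in axis; have a0 : 0 < a by rewrite mulr_gt0 // sqrtr_gt0.
set b := Num.sqrt (2 * c) in axis.
have b0 : 0 < b by rewrite sqrtr_gt0 mulr_gt0.
have b2 : b ^+ 2 = 2 * c by rewrite sqr_sqrtr // mulr_ge0 // ltW.
set D := (4 * (1 + C1) + (1 + C1) ^+ 2 + 1) / b in axis.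
have D0 : 0 <= D.
  by rewrite /D divr_ge0 ?(ltW b0) // !addr_ge0 ?mulr_ge0 ?exprn_ge0 ?addr_ge0.
clearbody a D; clearbody b.
(* Beyond kap M^2 the approximated windows of the model are at most 1/4. *)
have [kap kap1 kapa] : exists2 kap : nat, 1 <= kap%:R :> R & 8 * a ^+ 2 <= kap%:R.
  exists (Num.truncn (8 * a ^+ 2)).+1; first by rewrite ler1n.
  by rewrite ltW // truncnS_gt.
(* K M^2 will bound all the errors, and B collects K and the corrections to the
   main term, of order b L M^2; L is chosen first, so that this main term wins, then the
   precision d of the asymptotic hypotheses, and M last. *)
have [K KE] : exists K, K = 2 * a * D + 10 * a ^+ 2 + 13 + 12 * (2 * a + D).
  by eexists.
have [B BE] : exists B, B = K + D + 2 * a * kap%:R + D by eexists.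
have [L [Lb L2 Lk]] : exists L : nat,
    [/\ 4 * B < b * L%:R, 2 <= L%:R :> R & kap%:R <= L%:R :> R].
  exists (kap + 2 + (Num.truncn (4 * B / b)).+1)%N; split.
  - rewrite [ltRHS]mulrC -ltr_pdivrMr //; apply: lt_le_trans (truncnS_gt _) _.
    by rewrite ler_nat leq_addl.
  - by rewrite ler_nat; lia.
  - by rewrite ler_nat; lia.
have L0 : 0 < L%:R :> R by clear -L2; lra.
have L1 : 1 <= L%:R :> R by clear -L2; lra.
have [d d0 dL] : exists2 d : R, 0 < d & d * L%:R ^+ 3 = 1.
  exists (L%:R ^- 3); first by rewrite invr_gt0 exprn_gt0.
  by rewrite mulVf // expf_neq0 // gt_eqF.
have d20 : 0 < d ^+ 2 by rewrite exprn_gt0.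
have [C2 hC2] := Eo _ d20.
have [C3 C30 hC3] := Po _ d20.
have [M M1 MC] : exists2 M : nat, 1 <= M%:R :> R & `|C2| + C3 <= d ^+ 2 * M%:R.
  exists (Num.truncn ((`|C2| + C3) / d ^+ 2)).+1; first by rewrite ler1n.
  by rewrite [leRHS]mulrC -ler_pdivrMr // ltW // truncnS_gt.
have [l lE] : exists l : R, l = L%:R * M%:R by eexists.
have l1 : 2 <= l by rewrite lE -[2]mulr1 ler_pM.
have l0 : 0 < l by clear -l1; lra.
have l2 : 4 <= l ^+ 2 by rewrite expr2 (_ : 4 = 2 * 2) ?ler_pM // -natrM.
have Ml2 : M%:R <= l ^+ 2.
  rewrite expr2; apply: (@le_trans _ _ (1 * l)); last by apply: ler_pM => //; clear -l1; lra.
  by rewrite mul1r lE ler_peMl // ltW.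
have Cl : `|C2| + C3 <= d ^+ 2 * l ^+ 2.
  by apply: le_trans MC _; rewrite ler_pM2l.
(* q is closer to 1 than x and x <= q^2: half of the decay of x^n is spent on a
   factor n + 1, and q also bounds the radius sqrt x of the circle. *)
have [x xE] : exists x, x = 1 - l ^- 2 by eexists.
have [q qE] : exists q, q = 1 - (2 * l ^+ 2)^-1 by eexists.
have ql : (1 - q)^-1 = 2 * l ^+ 2 by rewrite qE subKr invrK.
have t0 : 0 < l ^- 2 by rewrite invr_gt0 exprn_gt0.
have t1 : l ^- 2 <= 4^-1 by rewrite lef_pV2 ?posrE ?exprn_gt0.
rewrite invfM mulrC in qE.
have x01 : 0 <= x < 1 by rewrite xE; clear -t0 t1; lra.
have q01 : 0 <= q < 1 by rewrite qE; clear -t0 t1; lra.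
have xq : x <= q by rewrite qE xE; clear -t0 t1; lra.
have xq2 : x <= q ^+ 2.
  rewrite qE xE; move: (l ^- 2) => t; have := sqr_ge0 t; clear; lra.
have xl : (1 - x)^-1 = l ^+ 2 by rewrite xE subKr invrK.
have [X0 hX] := axis q q01.
have [n0 n0E] : exists n0, n0 = (kap * M ^ 2)%N by eexists.
have [X X0X n0X] : exists2 X, (X0 <= X)%N & (n0 <= X)%N.
  by exists (maxn X0 n0); rewrite ?leq_maxl ?leq_maxr.
have [Zq ax] := hX X X0X.
set Z := tail_poly _ _ _ _ _ in Zq.
set S := \poly_(n < X) (s n)%:R in ax.
set G := \poly_(n < X) central_coef R n in ax.
have G0 y : 0 <= y -> 0 <= G.[y].
  by apply: horner_poly_ge0 => n; rewrite ltW ?central_coef_gt0.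
have m0 : 0 < M%:R :> R by apply: lt_le_trans M1.
have S_le y k : 0 <= y <= q -> 0 <= k -> (1 - y)^-1 <= k ^+ 2 -> S.[y] <= a * k + D.
  move=> yq k0 yk; have [y0 yq'] := andP yq.
  have y01 : 0 <= y < 1 by rewrite y0; apply: le_lt_trans yq' _; case/andP: q01.
  have Gk : G.[y] <= k.
    rewrite -ler_sqr ?nnegrE ?G0 //; apply: le_trans yk.
    exact: sqr_central_poly_le.
  have [_] := ax y yq; rewrite hornerZ ler_norml => /andP[_ h].
  have : a * G.[y] <= a * k by rewrite ler_pM2l.
  clear -h; lra.
have Sx_ge : b * l - D <= S.[x].
  have xq' : 0 <= x <= q by rewrite xq; case/andP: x01 => ->.
  have [V2] := ax x xq'; rewrite hornerZ ler_norml => /andP[h _].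
  rewrite xl -b2 -exprMn in V2.
  have x0 : 0 <= x by case/andP: x01.
  have : b * l <= a * G.[x].
    rewrite -ler_sqr ?nnegrE; first by move: V2; rewrite hornerZ.
    by apply: mulr_ge0; exact: ltW.
    by apply: mulr_ge0; [exact: ltW | exact: G0].
  clear -h; lra.
have Hx : M%:R / 2 <= (geom_poly R M).[x].
  have -> : M%:R / 2 = \sum_(j < M) (2^-1 : R) by rewrite sumr_const card_ord mulr_natl.
  rewrite /geom_poly horner_sum; apply: ler_sum => j _; rewrite hornerXn.
  have t01 : 0 <= l ^- 2 <= 1 by clear -t0 t1; lra.
  rewrite xE; apply: le_trans (bernoulli_ge j t01).
  have jt : j%:R * l ^- 2 <= 2^-1.
    rewrite ler_pdivrMr ?exprn_gt0 // mulrC ler_pdivlMr //.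
    have : j%:R <= M%:R :> R by rewrite ler_nat ltnW.
    have : M%:R * 2 <= l ^+ 2.
      apply: (@le_trans _ _ (l * 2)).
        by rewrite ler_pM2r // lE ler_peMl // ltW.
      by rewrite expr2 ler_pM2l.
    clear; lra.
  clear -jt; lra.
have n0R : n0%:R = kap%:R * M%:R ^+ 2 :> R by rewrite n0E natrM natrX.
have n0p : 0 < n0%:R :> R by rewrite n0R mulr_gt0 ?exprn_gt0 // (lt_le_trans ltr01).
(* Counting at a point y of the axis with y^m >= 1/2 for all m < n0. *)
have small : \sum_(m < n0) (s m)%:R <= 2 * (a * (2 * kap%:R * M%:R) + D).
  pose y := 1 - (2 * n0%:R)^-1 : R.
  have v0 : 0 < (2 * n0%:R)^-1 :> R by rewrite invr_gt0 mulr_gt0.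
  have n01 : 1 <= n0%:R :> R by rewrite ler1n -(@ltr0n R).
  have v1 : (2 * n0%:R)^-1 <= 1 :> R by rewrite invf_le1 ?mulr_gt0 //; clear -n01; lra.
  have yq : 0 <= y <= q.
    rewrite /y qE -invfM [l ^+ 2 * 2]mulrC; apply/andP; split; first by rewrite subr_ge0.
    rewrite lerD2l lerN2 lef_pV2 ?posrE ?mulr_gt0 ?exprn_gt0 //.
    rewrite ler_pM2l // n0R lE exprMn ler_pM2r ?exprn_gt0 //.
    by apply: le_trans Lk _; rewrite expr2 ler_peMl // ltW.
  have y0 : 0 <= y by case/andP: yq.
  apply: (@le_trans _ _ (2 * S.[y])).
    rewrite (horner_coef_wide _ (size_poly _ _)) mulr_sumr.
    apply: (@le_trans _ _ (\sum_(m < n0) 2 * (S`_m * y ^+ m))); last first.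
      apply: (ler_sum_widen (F := fun m => 2 * (S`_m * y ^+ m))) => // i.
      by rewrite !mulr_ge0 ?exprn_ge0 // coef_poly; case: ifP.
    apply: ler_sum => m _; rewrite coef_poly (leq_trans (ltn_ord m) n0X).
    have ym : 2^-1 <= y ^+ m.
      have v01 : 0 <= (2 * n0%:R : R)^-1 <= 1 by rewrite v1 ltW.
      apply: le_trans (bernoulli_ge m v01).
      have : m%:R * (2 * n0%:R)^-1 <= 2^-1 :> R.
        rewrite ler_pdivrMr ?mulr_gt0 // mulKf ?gt_eqF // ler_nat.
        by rewrite ltnW.
      clear; lra.
    rewrite mulrCA ler_peMr // mulrC -ler_pdivrMr // mul1r //.
  rewrite ler_pM2l //; apply: S_le; [exact: yq | by rewrite !mulr_ge0 |].
  rewrite /y subKr invrK n0R.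
  have -> : (2 * kap%:R * M%:R) ^+ 2 = 4 * kap%:R * (kap%:R * M%:R ^+ 2) :> R by ring.
  rewrite ler_pM2r; last by rewrite -n0R.
  clear -kap1; lra.
have EE : wnorm2 x (\poly_(n < X) E n) <= 2 * M%:R ^+ 3.
  have C2l : 0 <= `|C2| <= d ^+ 2 * l ^+ 2.
    by rewrite normr_ge0; apply: le_trans Cl; rewrite lerDl.
  have EC2 n : E n ^+ 4 <= d ^+ 2 * n.+1%:R + `|C2|.
    by apply: le_trans (hC2 n) _; rewrite lerD2l ler_norm.
  rewrite wnorm2_poly; apply: le_trans (sum_sqr_le_cube X d0 l0 x01 xl C2l EC2) _.
  have -> : 2 * d * l ^+ 3 = 2 * (d * L%:R ^+ 3) * M%:R ^+ 3 by rewrite lE; ring.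
  by rewrite dL mulr1.
have PP : wnorm2 x (\poly_(n < X) P n) <= 3 * (2 * a + D) * M%:R ^+ 2.
  have C3l : 0 <= C3 <= d ^+ 2 * l ^+ 2.
    by rewrite C30; apply: le_trans Cl; rewrite lerDr.
  have x01' : 0 <= x <= 1 by case/andP: x01 => -> /ltW.
  have xq2' : 0 <= x <= q ^+ 2 by case/andP: x01 => ->.
  have l1' : 1 <= l by clear -l1; lra.
  rewrite wnorm2_poly; apply: le_trans (hC3 X x x01') _.
  apply: (@le_trans _ _ (3 * d * l * S.[q])).
    rewrite (horner_coef_wide _ (size_poly _ _)) mulr_sumr; apply: ler_sum => n _.
    rewrite coef_poly ltn_ord [leRHS]mulrCA ler_wpM2l //.
    exact: sqrt_weight_le.
  have Sq : S.[q] <= a * (2 * l) + D.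
    apply: S_le; first by rewrite lexx andbT; case/andP: q01.
      by rewrite mulr_ge0 // ltW.
    by rewrite ql; move: (sqr_ge0 l); clear; lra.
  have dl0 : 0 < 3 * d * l by rewrite !mulr_gt0.
  apply: le_trans (ler_wpM2l (ltW dl0) Sq) _.
  apply: (@le_trans _ _ (3 * d * l * ((2 * a + D) * l))).
    have Dl : D <= D * l by rewrite ler_peMr.
    by rewrite ler_pM2l //; clear -Dl; lra.
  have -> : 3 * d * l * ((2 * a + D) * l) =
    3 * (2 * a + D) * M%:R ^+ 2 * (d * L%:R ^+ 2) by rewrite lE; ring.
  rewrite ler_piMr //.
    have aD0 : 0 <= 2 * a + D by clear -a0 D0; lra.
    by apply: mulr_ge0; [exact: mulr_ge0 | exact: exprn_ge0].
  by rewrite -[leRHS]dL ler_pM2l // [leRHS]exprS ler_peMl ?exprn_ge0 // ltW.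
have [x0 x1] := andP x01.
have x01' : 0 <= x <= 1 by rewrite x0 ltW.
pose r := Num.sqrt x.
have r2 : r ^+ 2 = x by rewrite sqr_sqrtr.
have r0 : 0 <= r by exact: sqrtr_ge0.
have [q0 q1] := andP q01.
have rq : r <= q by rewrite -ler_sqr ?nnegrE // r2.
have r01 : 0 <= r <= 1 by rewrite r0 (le_trans rq) // ltW.
have Zr : wnorm1 r Z <= 1 by apply: le_trans Zq; apply: wnorm1_mono; rewrite r0.
have SE : S ^+ 2 = (a *: G) ^+ 2 + 4 *: ((1 - 'X) * \poly_(n < X) E n)
    + ((1 - 'X) * \poly_(n < X) P n) ^+ 2 + Z.
  by rewrite /S /G -poly_scale; exact: tail_polyE.
have circ := circle_inequality M r01 m0 SE Zr; rewrite r2 in circ.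
have ule n : (n0 <= n)%N -> M%:R * a * central_coef R (n + M) <= 4^-1.
  move=> n0n; have g0 := central_coef_gt0 R (n + M).
  have mag0 : 0 <= M%:R * a * central_coef R (n + M).
    by rewrite ltW // mulr_gt0 // mulr_gt0.
  rewrite -ler_sqr ?nnegrE ?invr_ge0 // -(@ler_pM2l R 16) //.
  have -> : 16 * (4^-1 : R) ^+ 2 = 1 by field.
  apply: le_trans (sqr_central_coef_le R (n + M)).
  rewrite [(_ * _) ^+ 2]exprMn [(M%:R * a) ^+ 2]exprMn mulrA ler_wpM2r ?sqr_ge0 //.
  apply: (@le_trans _ _ (2 * n0%:R)).
    rewrite n0R; have -> : 16 * (M%:R ^+ 2 * a ^+ 2) = 2 * (8 * a ^+ 2 * M%:R ^+ 2) by ring.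
    by rewrite ler_pM2l // ler_wpM2r ?sqr_ge0.
  by rewrite -natrM ler_nat; clear -n0n; lia.
have DC y : 0 <= y <= x -> `|S.[y] - (a *: G).[y]| <= D.
  move=> /andP[y0 yx]; have yq : 0 <= y <= q by rewrite y0 (le_trans yx).
  by case: (ax y yq).
have exc := window_energy_gain x01' (ltW a0) DC ule.
have mass := @window_mass R s x M X n0 x01' n0X.
rewrite -/S -/G in exc mass.
have pos : 0 <= b * l - D.
  rewrite subr_ge0; apply: (@le_trans _ _ (4 * B)); last first.
    apply: (le_trans (ltW Lb)); rewrite ler_pM2l // lE ler_peMr // ltW //.
  have aD : 0 <= a * D by rewrite mulr_ge0 // ltW.
  have ak : 0 <= a * kap%:R by rewrite mulr_ge0 // ltW.
  rewrite BE KE; move: (sqr_ge0 a); clear -aD ak a0 D0; lra.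
set w := 2^-1 * _ in exc.
have w0 : 0 <= w.
  apply: mulr_ge0; first by rewrite invr_ge0.
  apply: sumr_ge0 => n _; case: ifP => // _.
  by rewrite mulr_ge0 ?exprn_ge0 // coef_geom_mul_nat.
apply: (@scale_contradiction R a b D K B kap%:R L%:R M%:R w) => //.
- exact: ltW.
- have h1 : M%:R / 2 * (b * l - D) <= (geom_poly R M).[x] * S.[x].
    by apply: ler_pM => //; rewrite divr_ge0.
  have h2 : M%:R * (\sum_(m < n0) (s m)%:R) <=
      M%:R * (2 * (a * (2 * kap%:R * M%:R) + D)) :> R by rewrite ler_pM2l.
  rewrite -lE /w mulVKf ?pnatr_eq0 //; apply: le_trans mass.
  exact: lerB.
have h3 : wnorm2 x (\poly_(n < X) E n) / M%:R <= 2 * M%:R ^+ 2.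
  by rewrite ler_pdivrMr // -mulrA -exprSr.
have MM : M%:R * M%:R = M%:R ^+ 2 :> R by rewrite expr2.
move: circ exc PP h3; rewrite KE MM; clear; lra.
Qed.

(** * Counting functions of two close enumerations *)

Lemma sum_enum (R : numDomainType) (a : nat -> nat) (S : pred nat) (f : nat -> R) (X : nat) :
  injective a -> (forall i, (i <= a i)%N) ->
  (forall n, reflect (exists i, a i = n) (S n)) ->
  \sum_(i < X) (if (a i < X)%N then f (a i) else 0) = \sum_(m < X) (S m)%:R * f m.
Proof.
move=> a_inj le_a aS.
have one (m : 'I_X) : \sum_(i < X) (a i == m)%:R = (S m)%:R :> R.
  case: aS => [[j ajm]|no]; last first.
    by rewrite big1 // => i _; case: eqP => // e; case: no; exists i.
  have jX : (j < X)%N by apply: leq_ltn_trans (ltn_ord m); rewrite -ajm.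
  rewrite (bigD1 (Ordinal jX)) //= ajm eqxx big1 ?addr0 // => i ij.
  case: eqP => // e; case/eqP: ij; apply/val_inj/a_inj => /=; by rewrite e.
under [RHS]eq_bigr do rewrite -one mulr_suml.
rewrite exchange_big; apply: eq_bigr => i _ /=.
case: ifP => [aX|aX].
  rewrite (bigD1 (Ordinal aX)) //= eqxx mul1r big1 ?addr0 // => m mi.
  by case: eqP => [e|]; rewrite ?mul0r //; case/eqP: mi; apply/val_inj.
rewrite big1 // => m _; case: eqP => [e|_]; last by rewrite mul0r.
by rewrite e ltn_ord in aX.
Qed.

Lemma count_interval (R : numDomainType) (u v X : nat) :
  \sum_(n < X) ((u <= n) && (n < v))%N%:R <= (v - u)%:R :> R.
Proof.
rewrite -natr_sum ler_nat.
have -> : (\sum_(n < X) ((u <= n) && (n < v)) =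
    \sum_(0 <= n < X | (u <= n) && (n < v)) 1)%N.
  by rewrite big_mkord [RHS]big_mkcond /=; apply: eq_bigr => n _; case: andb.
rewrite sum1_count -size_filter.
have sub : {subset [seq n <- index_iota 0 X | ((u <= n) && (n < v))%N] <= index_iota u v}.
  by move=> n; rewrite mem_filter => /andP[uv _]; rewrite mem_index_iota.
have := uniq_leq_size (filter_uniq _ (iota_uniq _ _)) sub.
by rewrite size_iota.
Qed.

(** The difference at n of the counting functions of SA and SB. *)
Definition count_diff (R : pzRingType) (SA SB : pred nat) (n : nat) : R :=
  \sum_(m < n.+1) ((SA m)%:R - (SB m)%:R).

Section Gap.

Variables (R : realType) (a b : nat -> nat) (SA SB : pred nat).

Hypotheses (a_inj : injective a) (b_inj : injective b).

Hypotheses (le_a : forall i, (i <= a i)%N) (le_b : forall i, (i <= b i)%N).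

Hypotheses (aS : forall n, reflect (exists i, a i = n) (SA n)).

Hypotheses (bS : forall n, reflect (exists i, b i = n) (SB n)).

Lemma count_below (c : nat -> nat) (S : pred nat) (n X : nat) :
  injective c -> (forall i, (i <= c i)%N) ->
  (forall n, reflect (exists i, c i = n) (S n)) -> (n < X)%N ->
  \sum_(m < n.+1) (S m)%:R = \sum_(i < X) (c i <= n)%:R :> R.
Proof.
move=> c_inj le_c cS nX.
have -> : \sum_(i < X) (c i <= n)%:R =
    \sum_(i < X) (if (c i < X)%N then (c i <= n)%:R else 0) :> R.
  apply: eq_bigr => i _; case: (ltnP (c i) X) => // Xc.
  by rewrite leqNgt (leq_trans nX Xc).
rewrite (sum_enum (fun m => (m <= n)%:R) X c_inj le_c cS).
rewrite (big_ord_widen X (fun m => (S m)%:R) nX) big_mkcond /=.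
by apply: eq_bigr => m _; rewrite ltnS; case: leqP; rewrite ?mulr1 ?mulr0.
Qed.

Lemma count_window (c : nat -> nat) (S : pred nat) (n X K : nat) :
  injective c -> (forall i, (i <= c i)%N) ->
  (forall n, reflect (exists i, c i = n) (S n)) -> (n < X)%N ->
  \sum_(i < X) ((c i <= n) && (n < c i + K))%N%:R <= K%:R :> R.
Proof.
move=> c_inj le_c cS nX.
have -> : \sum_(i < X) ((c i <= n) && (n < c i + K))%N%:R =
    \sum_(i < X) (if (c i < X)%N then ((c i <= n) && (n < c i + K))%N%:R else 0) :> R.
  apply: eq_bigr => i _; case: (ltnP (c i) X) => // Xc.
  by rewrite leqNgt (leq_trans nX Xc).
rewrite (sum_enum (fun m => ((m <= n) && (n < m + K))%N%:R) X c_inj le_c cS).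
apply: (@le_trans _ _ (\sum_(m < X) ((m <= n) && (n < m + K))%N%:R)).
  by apply: ler_sum => m _; rewrite ler_piMl // lern1 leq_b1.
apply: (@le_trans _ _ (n.+1 - (n.+1 - K))%:R); last by rewrite ler_nat; lia.
apply: le_trans (count_interval R _ _ X); apply: ler_sum => m _.
by rewrite ler_nat; case: (leqP m n) => //=; case: (ltnP n (m + K)) => //=; lia.
Qed.

(** The index i contributes to the difference of the counting functions at n exactly
    when n separates a i from b i. *)
Definition between (i n : nat) : bool :=
  ((a i <= n) && (n < b i))%N || ((b i <= n) && (n < a i))%N.

Lemma count_diff_le_between (n X : nat) : (n < X)%N ->
  `|count_diff R SA SB n| <= \sum_(i < X) (between i n)%:R.
Proof.
move=> nX; rewrite /count_diff sumrB (count_below a_inj le_a aS nX).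
rewrite (count_below b_inj le_b bS nX) -sumrB.
apply: le_trans (ler_norm_sum _ _ _) _; apply: ler_sum => i _.
rewrite /between; case: (leqP (a i) n); case: (leqP (b i) n) => //= _ _.
- by rewrite subrr normr0.
- by rewrite subr0 normr1.
- by rewrite sub0r normrN normr1.
- by rewrite subrr normr0.
Qed.

Variables (e C : R).

Hypotheses (e01 : 0 < e <= 1) (C0 : 0 <= C).

Hypothesis gapa : forall i, ((a i)%:R - (b i)%:R) ^+ 4 <= e * (a i)%:R + C :> R.

Hypothesis gapb : forall i, ((a i)%:R - (b i)%:R) ^+ 4 <= e * (b i)%:R + C :> R.

Definition quart (z : R) : R := Num.sqrt (Num.sqrt z).

Lemma quart_ge0 z : 0 <= quart z. Proof. exact: sqrtr_ge0. Qed.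

Lemma le_quart (p z : R) : p ^+ 4 <= z -> `|p| <= quart z.
Proof.
move=> pz; rewrite -sqrtr_sqr; apply: ler_wsqrtr.
rewrite -[p ^+ 2]ger0_norm ?sqr_ge0 // -sqrtr_sqr; apply: ler_wsqrtr.
by rewrite -exprM.
Qed.

Lemma gap_le i n : (minn (a i) (b i) <= n)%N ->
  `|(a i)%:R - (b i)%:R| <= quart (e * n%:R + C).
Proof.
have [e0 _] := andP e01.
move=> mn; apply: le_quart.
have [ab|ba] := leqP (a i) (b i).
  apply: le_trans (gapa i) _; rewrite lerD2r ler_pM2l // ler_nat.
  by apply: leq_trans mn; rewrite leq_min leqnn.
apply: le_trans (gapb i) _; rewrite lerD2r ler_pM2l // ler_nat.
by apply: leq_trans mn; rewrite leq_min leqnn ltnW.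
Qed.

(** The a i with a i <= n < b i are distinct integers within the maximal gap of n,
    so the gap bounds their number; likewise with a and b exchanged. *)
Lemma count_diff_le (n : nat) : `|count_diff R SA SB n| <= 2 * quart (e * n%:R + C).
Proof.
apply: le_trans (count_diff_le_between (ltnSn n)) _.
set K := Num.truncn (quart (e * n%:R + C)).
apply: (@le_trans _ _ (2 * K%:R)); last first.
  by rewrite ler_pM2l // truncn_le // quart_ge0.
have dist i : (minn (a i) (b i) <= n)%N -> (a i <= b i + K)%N /\ (b i <= a i + K)%N.
  move=> /gap_le; rewrite ler_norml => /andP[h1 h2].
  have q0 := quart_ge0 (e * n%:R + C).
  have ck (u v : nat) : u%:R - v%:R <= quart (e * n%:R + C) -> (u <= v + K)%N.
    move=> uv; have [vu|/ltnW] := leqP v u; last by move=> /leq_trans; apply; exact: leq_addr.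
    by rewrite -leq_subLR /K truncn_ge_nat ?quart_ge0 // natrB.
  by split; apply: ck; lra.
rewrite mulr_natl mulr2n.
apply: le_trans (lerD (count_window K a_inj le_a aS (ltnSn n))
  (count_window K b_inj le_b bS (ltnSn n))).
rewrite -big_split /=; apply: ler_sum => i _; rewrite -natrD ler_nat /between.
have [[] |] := boolP (minn (a i) (b i) <= n)%N.
  by move=> /dist[]; case: (leqP (a i) n); case: (leqP (b i) n) => //=; lia.
by rewrite geq_min negb_or => /andP[/negbTE -> /negbTE ->].
Qed.

Lemma betweenE i n : between i n = ((minn (a i) (b i) <= n) && (n < maxn (a i) (b i)))%N.
Proof. by rewrite /between geq_min leq_max; case: leqP; case: leqP => //=; lia. Qed.

Lemma quart_mono (y z : R) : y <= z -> quart y <= quart z.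
Proof. by move=> yz; rewrite /quart; apply: ler_wsqrtr; apply: ler_wsqrtr. Qed.

(** One factor of the square is expanded over the indices i that separate at n, the
    other one is bounded by the gap at n. Each index i then contributes for at
    most gap-many n, that is about the square of its gap, and is charged to the
    smaller one of a i and b i. *)
Lemma count_diff_energy (X : nat) (x : R) : 0 <= x <= 1 ->
  \sum_(n < X) count_diff R SA SB n ^+ 2 * x ^+ n <=
  \sum_(n < X) (SA n + SB n)%:R *
    (Num.sqrt (8 * e * n.+1%:R + (4 + 8 * C)) * x ^+ n).
Proof.
move=> /andP[x0 x1]; have [e0 e1] := andP e01.
pose f n := Num.sqrt (8 * e * n.+1%:R + (4 + 8 * C)) * x ^+ n.
have f0 n : 0 <= f n by rewrite mulr_ge0 ?sqrtr_ge0 ?exprn_ge0.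
pose m i := minn (a i) (b i).
(* While n runs between a_i and b_i it stays comparable to their minimum, at
   which everything can therefore be evaluated. *)
have term i n : between i n ->
    2 * quart (e * n%:R + C) * x ^+ n <=
    2 * quart (2 * e * (m i)%:R + (1 + 2 * C)) * x ^+ m i.
  rewrite betweenE => /andP[mn nM].
  apply: ler_pM; rewrite ?mulr_ge0 ?quart_ge0 ?exprn_ge0 //; last first.
    exact: ler_wiXn2l.
  rewrite ler_pM2l //; apply: quart_mono.
  have mi4 : ((a i)%:R - (b i)%:R) ^+ 4 <= e * (m i)%:R + C.
    by rewrite /m; case: leqP.
  have nm : n%:R <= (m i)%:R + `|(a i)%:R - (b i)%:R| :> R.
    apply: (@le_trans _ _ (maxn (a i) (b i))%:R); first by rewrite ler_nat ltnW.
    rewrite /m; case: leqP => h.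
      by rewrite distrC; have := ler_norm ((b i)%:R - (a i)%:R : R); lra.
    by have := ler_norm ((a i)%:R - (b i)%:R : R); lra.
  have D1 := le_add_quartic ((a i)%:R - (b i)%:R : R) ltr01.
  rewrite expr1n divr1 in D1.
  have m0 : 0 <= (m i)%:R :> R by [].
  have : n%:R <= (m i)%:R + (1 + (e * (m i)%:R + C)) by lra.
  move: (n%:R : R) ((m i)%:R : R) m0 => N k k0 Nk.
  have ee : e * N <= e * (k + (1 + (e * k + C))) by rewrite ler_pM2l.
  have e2 : e * (e * k) <= e * k by rewrite ler_piMl // mulr_ge0 // ltW.
  have e3 : e * C <= C by rewrite ler_piMl.
  lra.
have inner i : \sum_(n < X) (between i n)%:R * (2 * quart (e * n%:R + C) * x ^+ n) <=
    (if (m i < X)%N then f (m i) else 0).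
  case: ltnP => mX; last first.
    rewrite big1 // => n _; rewrite betweenE -/(m i) leqNgt.
    by rewrite (leq_trans (ltn_ord n) mX) mul0r.
  set w := 2 * e * (m i)%:R + (1 + 2 * C).
  have w0 : 0 <= w by rewrite !addr_ge0 ?mulr_ge0 // ltW.
  apply: (@le_trans _ _ (\sum_(n < X) (between i n)%:R * (2 * quart w * x ^+ m i))).
    apply: ler_sum => n _; have := term i n; case: between => [/(_ isT) h|_].
      by rewrite ler_wpM2l.
    by rewrite !mul0r.
  rewrite -mulr_suml.
  have dist : \sum_(n < X) (between i n)%:R <= quart w.
    under eq_bigr do rewrite betweenE.
    apply: le_trans (count_interval R _ _ X) _.
    have -> : (maxn (a i) (b i) - minn (a i) (b i))%:R = `|(a i)%:R - (b i)%:R| :> R.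
      case: (leqP (a i) (b i)) => h; first by rewrite distrC -natrB // normr_nat.
      by rewrite -natrB 1?ltnW // normr_nat.
    apply: le_trans (gap_le (leqnn _)) _; apply: quart_mono; rewrite -/(m i) /w.
    have em : 0 <= e * (m i)%:R by rewrite mulr_ge0 // ltW.
    by move: C0 em; move: ((m i)%:R : R) => k; lra.
  have q0 : 0 <= 2 * quart w * x ^+ m i.
    by rewrite mulr_ge0 ?exprn_ge0 // mulr_ge0 ?quart_ge0.
  apply: le_trans (ler_wpM2r q0 dist) _.
  have -> : quart w * (2 * quart w * x ^+ m i) = 2 * quart w ^+ 2 * x ^+ m i by ring.
  rewrite /quart sqr_sqrtr ?sqrtr_ge0 // /f ler_wpM2r ?exprn_ge0 //.
  have -> : 2 * Num.sqrt w = Num.sqrt (4 * w).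
    rewrite sqrtrM //; congr (_ * _); rewrite (_ : 4 = 2 ^+ 2) -?natrX //.
    by rewrite natrX sqrtr_sqr ger0_norm.
  apply: ler_wsqrtr; rewrite /w -[(m i).+1%:R]natr1.
  by move: e0 C0; move: ((m i)%:R : R) => k; lra.
apply: (@le_trans _ _ (\sum_(n < X) \sum_(i < X)
    (between i n)%:R * (2 * quart (e * n%:R + C) * x ^+ n))).
  apply: ler_sum => n _; rewrite -mulr_suml mulrA ler_wpM2r ?exprn_ge0 //.
  rewrite -real_normK ?num_real // expr2.
  by apply: ler_pM => //; [exact: count_diff_le_between | exact: count_diff_le].
rewrite exchange_big /=; apply: le_trans (ler_sum _ (fun (i : 'I_X) _ => inner i)) _.
apply: (@le_trans _ _ (\sum_(i < X) ((if (a i < X)%N then f (a i) else 0)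
    + (if (b i < X)%N then f (b i) else 0)))).
  apply: ler_sum => i _; rewrite /m; case: (leqP (a i) (b i)) => _.
    by rewrite lerDl; case: ifP.
  by rewrite lerDr; case: ifP.
rewrite big_split /= (sum_enum f X a_inj le_a aS) (sum_enum f X b_inj le_b bS).
rewrite -big_split /= le_eqVlt; apply/orP; left; apply/eqP/eq_bigr => n _.
by rewrite -mulrDl natrD.
Qed.

End Gap.

(** * Representation counts and asymptotics *)

(** The pairs are sorted by their sum k. *)
Lemma rep_countE (A B : set nat) (n : nat) :
  rep_count A B n =
  (\sum_(k < n.+1) \sum_(i < k.+1) ((i : nat) \in A) * ((k - i)%N \in B))%N.
Proof.
rewrite /rep_count.
pose s := [seq (i, (k - i)%N) | k <- iota 0 n.+1, i <- iota 0 k.+1].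
have us : uniq s.
  apply: allpairs_uniq_dep; [exact: iota_uniq | by move=> *; exact: iota_uniq |].
  move=> u v /allpairsPdep[k1 [i1 [_ + ->]]] /allpairsPdep[k2 [i2 [_ + ->]]].
  rewrite !mem_iota /= => ik1 ik2 [e1 e2]; subst i2.
  by have -> : k1 = k2 by lia.
have -> : #|` fset_set (rep_pairs A B n)|%fset =
    size [seq p <- s | (p.1 \in A) && (p.2 \in B)].
  apply/perm_size/uniq_perm; [exact: fset_uniq | exact: filter_uniq |].
  move=> [x y]; rewrite mem_filter.
  rewrite (in_fset_set (finite_rep_pairs A B n)) /=.
  apply/idP/idP.
    rewrite inE => -[/= Ax By xyn]; rewrite !mem_set //=.
    apply/allpairsPdep; exists (x + y)%N, x; rewrite !mem_iota addKn; split=> //; lia.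
  case/andP=> /andP[Ax By] /allpairsPdep[k [i [+ + [xi yi]]]].
  rewrite !mem_iota => /= kn ik; rewrite inE; split => /=.
  - by move: Ax; rewrite inE.
  - by move: By; rewrite inE.
  - lia.
rewrite size_filter -sum1_count big_mkcond /s big_allpairs_dep /=.
have iotaE (m : nat) (F : nat -> nat) : \sum_(i <- iota 0 m) F i = (\sum_(i < m) F i)%N.
  by rewrite -{1}[m]subn0 -/(index_iota 0 m) big_mkord.
rewrite (iotaE n.+1); apply: eq_bigr => k _; rewrite (iotaE k.+1); apply: eq_bigr => i _.
by case: (_ \in A); case: (_ \in B).
Qed.

(** From here on fourth powers replace the real exponent 1 / 4, and the constant C
    replaces the quantification over large indices. *)
Lemma littleo_quartic (R : realType) (u : nat -> R) (v : nat -> nat) :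
  u =o_\oo (fun i => (v i)%:R `^ (1 / 4) : R) ->
  forall e : R, 0 < e -> exists2 C : R, 0 <= C &
    forall i, u i ^+ 4 <= e * (v i)%:R + C.
Proof.
move=> /eqoP uo e e0.
(* With d <= 1, d ^ 4 <= d <= e; the finitely many remaining indices go into C. *)
pose d : R := Num.min 1 e.
have d0 : 0 < d by rewrite lt_min ltr01.
have [N _ hN] := uo d d0.
exists (\sum_(i < N) u i ^+ 4); first by apply: sumr_ge0 => i _; exact: exprn_even_ge0.
have S0 : 0 <= \sum_(i < N) u i ^+ 4 by apply: sumr_ge0 => i _; exact: exprn_even_ge0.
move=> i; have [iN|Ni] := ltnP i N.
  rewrite (bigD1 (Ordinal iN)) //= addrCA lerDl addr_ge0 ?mulr_ge0 ?(ltW e0) //.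
  by apply: sumr_ge0 => j _; exact: exprn_even_ge0.
apply: ler_wpDr => //.
have := hN i Ni; rewrite /= [X in _ * X]ger0_norm ?powR_ge0 // => h.
have -> : u i ^+ 4 = `|u i| ^+ 4 by rewrite -normrX ger0_norm ?exprn_even_ge0.
have p4 : ((v i)%:R `^ (1 / 4)) ^+ 4 = (v i)%:R :> R.
  by rewrite -powR_mulrn ?powR_ge0 // -powRrM mul1r mulVf // powRr1.
apply: (@le_trans _ _ ((d * (v i)%:R `^ (1 / 4)) ^+ 4)).
  by rewrite lerXn2r ?nnegrE // mulr_ge0 ?powR_ge0 // ltW.
rewrite exprMn p4 ler_wpM2r //.
have d1 : d <= 1 by rewrite ge_min lexx.
have de : d <= e by rewrite ge_min lexx orbT.
apply: le_trans de; rewrite exprS ler_piMr ?exprn_ile1 // ltW //.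
Qed.

Lemma quart_pow4 (R : realType) (z : R) : 0 <= z -> quart z ^+ 4 = z.
Proof. by move=> z0; rewrite /quart (exprM _ 2 2) !sqr_sqrtr ?sqrtr_ge0. Qed.

(** A gap that is small compared with x makes x and y comparable, so that it is
    small compared with y too. *)
Lemma quartic_gap_sym (R : realFieldType) (x y e C : R) :
  0 <= x -> 0 <= y -> 0 < e <= 1 -> 0 <= C -> (x - y) ^+ 4 <= e / 2 * x + C ->
  (x - y) ^+ 4 <= e * x + (2 * C + 1) /\ (x - y) ^+ 4 <= e * y + (2 * C + 1).
Proof.
move=> x0 y0 /andP[e0 e1] C0 gap.
have ex : 0 <= e * x by rewrite mulr_ge0 // ltW.
split; first lra.
have D1 := le_add_quartic (x - y) ltr01; rewrite expr1n divr1 in D1.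
have xy : x <= y + (1 + (x - y) ^+ 4) by have := ler_norm (x - y); lra.
have p0 : 0 <= (x - y) ^+ 4 by exact: exprn_even_ge0.
move: gap xy p0; move: ((x - y) ^+ 4) => p gap xy p0.
have h : e * x <= e * (y + (1 + p)) by rewrite ler_pM2l.
have h2 : e * p <= p by rewrite ler_piMl.
lra.
Qed.

Lemma count_diff_delay (R : pzRingType) (SA SB : pred nat) (n : nat) :
  count_diff R SA SB n - delay (count_diff R SA SB) n = (SA n)%:R - (SB n)%:R.
Proof.
case: n => [|n] /=; first by rewrite /count_diff big_ord1 subr0.
by rewrite {1}/count_diff big_ord_recr /= addrAC subrr add0r.
Qed.

(** Reversing the sum makes the two mixed convolutions equal. *)
Lemma sum_polarization (R : comPzRingType) (f g : nat -> R) (n : nat) :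
  \sum_(i < n.+1) (f i + g i) * (f (n - i)%N + g (n - i)%N) =
  4 * (\sum_(i < n.+1) f i * g (n - i)%N)
  + \sum_(i < n.+1) (f i - g i) * (f (n - i)%N - g (n - i)%N).
Proof.
have rev : \sum_(i < n.+1) f i * g (n - i)%N = \sum_(i < n.+1) g i * f (n - i)%N.
  rewrite (reindex_inj rev_ord_inj); apply: eq_bigr => i _ /=.
  by rewrite subSS subKn -1?ltnS // mulrC.
have -> : 4 * (\sum_(i < n.+1) f i * g (n - i)%N) =
    2 * (\sum_(i < n.+1) f i * g (n - i)%N) + 2 * (\sum_(i < n.+1) g i * f (n - i)%N).
  by rewrite -rev; ring.
rewrite !mulr_sumr -!big_split; apply: eq_bigr => i _ /=; ring.
Qed.

Lemma lists_in_order_inj (a : nat -> nat) (A : set nat) :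
  lists_in_order a A -> injective a.
Proof. by move=> [mono _] i j aij; apply/eqP; rewrite eqn_leq -!mono aij lexx. Qed.

Lemma lists_in_order_ge (a : nat -> nat) (A : set nat) :
  lists_in_order a A -> forall i, (i <= a i)%N.
Proof.
move=> [mono _]; elim=> // i IH; apply: leq_ltn_trans IH _.
by rewrite ltnNge; apply/negP; rewrite -leEnat mono ltnn.
Qed.

Lemma lists_in_orderP (a : nat -> nat) (A : set nat) :
  lists_in_order a A -> forall n, reflect (exists i, a i = n) (n \in A).
Proof.
move=> [_ rng] n; apply: (iffP idP) => [|[i <-]]; rewrite inE -rng.
  by move=> [i _ <-]; exists i.
by exists i.
Qed.

Theorem corollary1 (R : realType) (A B : set nat) (a b : nat -> nat)
    (infA : infinite_set A) (infB : infinite_set B)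
    (aA : lists_in_order a A) (bB : lists_in_order b B)
    (ab : (fun i : nat => (a i)%:R - (b i)%:R : R)
            =o_\oo (fun i : nat => (a i)%:R `^ (1 / 4) : R)) :
  ~ exists2 c : R, 0 < c &
      (fun n : nat => (rep_count A B n)%:R : R)
        = (fun n : nat => c * n%:R : R)
          +o_\oo (fun n : nat => n%:R `^ (1 / 4) : R).
Proof.
case=> c c0 repc.
have [a_inj le_a] := (lists_in_order_inj aA, lists_in_order_ge aA).
have [b_inj le_b] := (lists_in_order_inj bB, lists_in_order_ge bB).
have [aS bS] := (lists_in_orderP aA, lists_in_orderP bB).
pose SA n := n \in A; pose SB n := n \in B.
pose rho n : R := \sum_(i < n.+1) (SA i)%:R * (SB (n - i)%N)%:R.
pose E n : R := \sum_(k < n.+1) rho k - c * n.+1%:R.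
have repE n : (rep_count A B n)%:R = \sum_(k < n.+1) rho k.
  rewrite rep_countE natr_sum; apply: eq_bigr => k _.
  by rewrite natr_sum; apply: eq_bigr => i _; rewrite natrM.
have gap e : 0 < e <= 1 -> exists2 C : R, 0 <= C & forall i,
    ((a i)%:R - (b i)%:R) ^+ 4 <= e * (a i)%:R + C /\
    ((a i)%:R - (b i)%:R) ^+ 4 <= e * (b i)%:R + C.
  move=> e01; have [e0 _] := andP e01.
  have e20 : 0 < e / 2 by rewrite divr_gt0.
  have [C C0 hC] := littleo_quartic ab e20.
  exists (2 * C + 1); first by rewrite addr_ge0 ?mulr_ge0.
  by move=> i; apply: quartic_gap_sym => //; exact: hC.
apply: (@no_linear_asymptotics R (fun n => (SA n + SB n)%N) E (count_diff R SA SB) c c0).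
- by move=> n; case: (SA n); case: (SB n).
- move=> n; under eq_bigr do rewrite !natrD.
  rewrite (sum_polarization (fun n => (SA n)%:R) (fun n => (SB n)%:R)) -/(rho n).
  have -> : E n - delay E n = rho n - c.
    case: n => [|n] /=; rewrite /E; first by rewrite big_ord1 subr0 mulr1.
    by rewrite big_ord_recr /= -[n.+2%:R]natr1; ring.
  congr (_ + _); first by ring.
  by apply: eq_bigr => i _; rewrite !count_diff_delay.
- move=> e e0; have e80 : 0 < e / 8 by rewrite divr_gt0.
  have uo : (fun n => (rep_count A B n)%:R - c * n%:R : R)
      =o_\oo (fun n : nat => n%:R `^ (1 / 4) : R).
    by apply/eqoP; move/eqaddoP: repc.
  have [C C0 hC] := littleo_quartic (v := id) uo e80.
  exists (8 * C + 8 * c ^+ 4) => n.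
  have -> : E n = (rep_count A B n)%:R - c * n%:R - c.
    by rewrite repE /E -[n.+1%:R]natr1; ring.
  have := hC n; move: (_ - _) => u hu.
  have pow4 : (u - c) ^+ 4 <= 8 * u ^+ 4 + 8 * c ^+ 4.
    have sq (x y : R) : (x - y) ^+ 2 <= 2 * x ^+ 2 + 2 * y ^+ 2.
      by have := sqr_ge0 (x + y); lra.
    have := sq (u ^+ 2) (c ^+ 2); have := sqr_ge0 (u ^+ 2 - c ^+ 2).
    have := sq u c; have := sqr_ge0 (u - c).
    rewrite (exprM (u - c) 2 2) (exprM u 2 2) (exprM c 2 2).
    move: ((u - c) ^+ 2) (u ^+ 2) (c ^+ 2) => p q r p0 pq h1 h2.
    have : p ^+ 2 <= (2 * q + 2 * r) ^+ 2 by rewrite lerXn2r ?nnegrE //; lra.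
    lra.
  rewrite /= in hu; rewrite -[n.+1%:R]natr1; lra.
- have e01 : 0 < (1 : R) <= 1 by rewrite ltr01 lexx.
  have [C C0 hC] := gap 1 e01.
  exists (16 * (1 + C)) => n.
  have := count_diff_le a_inj b_inj le_a le_b aS bS e01 C0 (fun i => (hC i).1) (fun i => (hC i).2) n.
  set z := 1 * n%:R + C => Pz.
  have z0 : 0 <= z by rewrite addr_ge0 ?mulr_ge0.
  have -> : count_diff R SA SB n ^+ 4 = `|count_diff R SA SB n| ^+ 4.
    by rewrite -normrX ger0_norm ?exprn_even_ge0.
  apply: (@le_trans _ _ ((2 * quart z) ^+ 4)).
    by rewrite lerXn2r ?nnegrE ?mulr_ge0 ?quart_ge0.
  rewrite exprMn quart_pow4 // /z -[n.+1%:R]natr1 (_ : 2 ^+ 4 = 16); last by ring.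
  have : 0 <= C * n%:R by rewrite mulr_ge0.
  have : 0 <= n%:R :> R by [].
  lra.
move=> e e0; pose d := Num.min 1 (e / 8).
have d01 : 0 < d <= 1 by rewrite lt_min ltr01 divr_gt0 // ge_min lexx.
have de : 8 * d <= e.
  by have : d <= e / 8 by [rewrite ge_min lexx orbT]; lra.
have [C C0 hC] := gap d d01.
exists (4 + 8 * C); first by rewrite addr_ge0 ?mulr_ge0.
move=> X x x01.
have [x0 _] := andP x01.
apply: le_trans (count_diff_energy a_inj b_inj le_a le_b aS bS d01 C0
  (fun i => (hC i).1) (fun i => (hC i).2) X x01) _.
apply: ler_sum => n _; rewrite ler_wpM2l // ler_wpM2r ?exprn_ge0 //.
by apply: ler_wsqrtr; rewrite lerD2r ler_wpM2r.
Qed.
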